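(* Assume that $\eta(x)=0$ for every $x\ge0$. Let $\bar u=\mathbf{1}_{]-1,0[}$, i.e. $\bar u(x)=1$ for $-1<x<0$ and $\bar u(x)=0$ otherwise. For $0<\varepsilon\le1$ let $u_\varepsilon$ be the solution of $$\partial_t u_\varepsilon+\partial_x\big[u_\varepsilon\,(u_\varepsilon*\eta_\varepsilon)\big]=0,\qquad u_\varepsilon(0,\cdot)=\bar u,$$ and let $u$ be the (Kruzkov) entropy admissible solution of the Burgers equation $$\partial_t u+\partial_x[u^2]=0,\qquad u(0,\cdot)=\bar u .$$ Then: (1) for every $T>0$ there is no sequence $\varepsilon_k\to0^+$ such that $u_{\varepsilon_k}\rightharpoonup u$ weakly in $L^p([0,T]\times\mathbb{R})$ for some $p\in[1,+\infty[$, or weakly$^*$ in $L^\infty([0,T]\times\mathbb{R})$; (2) more generally, let $T>0$, let $\varepsilon_k\to0^+$, and suppose that $u_{\varepsilon_k}$ converges to some $w$ weakly in $L^p([0,T]\times\mathbb{R})$ for some $p\in[1,+\infty[$, or weakly$^*$ in $L^\infty([0,T]\times\mathbb{R})$. Then $w$ is not an $L^2_{\mathrm{loc}}$ distributional (not necessarily entropy admissible) solution on $[0,T]\times\mathbb{R}$ of the Cauchy problem $\partial_t w+\partial_x[w^2]=0$, $w(0,\cdot)=\bar u$.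
   Context: The space dimension is one. The kernel $\eta:\mathbb{R}\to\mathbb{R}$ satisfies $\eta\in C_c^\infty(\mathbb{R})$, $\eta(x)=0$ for $|x|\ge1$, $\eta\ge0$, $\int_{\mathbb{R}}\eta\,dx=1$, and $\eta_\varepsilon(x):=\varepsilon^{-1}\eta(x/\varepsilon)$ for $0<\varepsilon\le1$. Convolution is with respect to $x$ only. The solution $u_\varepsilon$ is the unique distributional solution in $L^\infty_{\mathrm{loc}}([0,+\infty[;L^\infty(\mathbb{R}))\cap C^0([0,+\infty[;L^1(\mathbb{R}))$. A distributional solution $w$ on $[0,T]\times\mathbb{R}$ of the Burgers Cauchy problem means $\int_0^T\!\int_{\mathbb{R}}(w\,\partial_t\varphi+w^2\,\partial_x\varphi)\,dx\,dt+\int_{\mathbb{R}}\varphi(0,x)\bar u(x)\,dx=0$ for every $\varphi\in C_c^\infty(\,]-\infty,T[\,\times\mathbb{R})$. *)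

(* Defs.v *)
From HB Require Import structures.
From mathcomp Require Import all_boot all_order all_algebra.
From mathcomp Require Import all_classical all_reals all_analysis.

Set Implicit Arguments.
Unset Strict Implicit.
Unset Printing Implicit Defensive.
Import Order.TTheory GRing.Theory Num.Theory.
Import numFieldNormedType.Exports.

Local Open Scope classical_set_scope.
Local Open Scope ring_scope.

(* Space-time points are pairs z = (t, x) : R * R. *)

Notation leb1 := lebesgue_measure.
Notation leb2 := (lebesgue_measure \x lebesgue_measure)%E.

Section Definitions.
Variable R : realType.
Implicit Types (T : \bar R) (u v w f g phi : R * R -> R) (k wbar : R -> R).

Definition dt phi : R * R -> R := fun z => 'D_((1, 0) : R * R) phi z.
Definition dx phi : R * R -> R := fun z => 'D_((0, 1) : R * R) phi z.

Fixpoint Ck (n : nat) phi : Prop :=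
  continuous phi /\
  (if n is m.+1 then
    [/\ forall z, derivable phi z ((1, 0) : R * R),
        forall z, derivable phi z ((0, 1) : R * R),
        Ck m (dt phi) & Ck m (dx phi)]
   else True).

(* C_c^oo(]-oo, T[ x R); T = +oo gives C_c^oo(R x R). *)
Definition test_function T phi : Prop :=
  (forall n, Ck n phi) /\
  exists K : set (R * R), [/\ compact K, K `<=` [set z | (z.1%:E < T)%E] &
    forall z, ~ K z -> phi z = 0].

(* [0, T] x R for T finite, [0, +oo[ x R for T = +oo. *)
Definition slab T : set (R * R) := [set z | 0 <= z.1 /\ (z.1%:E <= T)%E].

(* w is a distributional solution on the slab of  w_t + f_x = 0, w(0,.) = wbar,
   where f is the flux already evaluated along w. *)
Definition distributional_solution T wbar w f : Prop :=
  forall phi, test_function T phi ->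
    \int[leb2]_(z in slab T) (w z * dt phi z + f z * dx phi z)
    + \int[leb1]_x (phi (0, x) * wbar x) = 0.

Definition convolution_kernel k : Prop :=
  [/\ forall n x, derivable (derive1n n k) x 1,
      forall x, 1 <= `|x| -> k x = 0,
      forall x, 0 <= k x
    & \int[leb1]_x k x = 1].

Definition rescale (eps : R) k : R -> R := fun x => eps^-1 * k (x / eps).

Definition conv_x v k : R * R -> R :=
  fun z => \int[leb1]_y (v (z.1, z.2 - y) * k y).

(* L^oo_loc([0,+oo[; L^oo(R)) /\ C^0([0,+oo[; L^1(R)).  A class in this space
   always has a jointly Borel representative v whose section v(t,.) is the
   value at t of the curve in L^1(R) for every t >= 0 (not only for almost
   every t); v is such a representative. *)
Definition solution_space v : Prop :=
  [/\ measurable_fun (slab +oo) v,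
      forall T0 : R, exists M : R, {ae leb1, forall t : R, 0 <= t <= T0 ->
        {ae leb1, forall x : R, `|v (t, x)| <= M}},
      forall t : R, 0 <= t -> leb1.-integrable setT (fun x : R => (v (t, x))%:E)
    & forall t0 : R, 0 <= t0 ->
        \int[leb1]_x `|v (t, x) - v (t0, x)|
          @[t --> within [set t : R | 0 <= t] (nbhs t0)] --> (0 : R)].

Definition nonlocal_solution k wbar v : Prop :=
  solution_space v /\
  distributional_solution +oo wbar v (fun z => v z * conv_x v k z).

Definition Lp_slab T (p : \bar R) f : Prop := f \_ (slab T) \in Lfun leb2 p.

Definition L2loc_slab T w : Prop :=
  measurable_fun (slab T) w /\
  forall K : set (R * R), compact K -> K `<=` slab T ->
    leb2.-integrable K (fun z => (w z ^+ 2)%:E).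

Definition L2loc_burgers_solution T wbar w : Prop :=
  L2loc_slab T w /\ distributional_solution T wbar w (fun z => w z ^+ 2).

(* Kruzkov's entropy solution: bounded, with the initial datum included in the
   entropy inequalities. *)
Definition entropy_solution wbar u : Prop :=
  Lp_slab +oo +oo u /\
  forall (c : R) phi, test_function +oo phi -> (forall z, 0 <= phi z) ->
    0 <= \int[leb2]_(z in slab +oo)
           (`|u z - c| * dt phi z
            + Num.sg (u z - c) * (u z ^+ 2 - c ^+ 2) * dx phi z)
         + \int[leb1]_x (phi (0, x) * `|wbar x - c|).

(* Convergence in L^p([0,T] x R) tested against L^q([0,T] x R). *)
Definition pairing_cvg T (p q : \bar R) (vn : nat -> R * R -> R) w : Prop :=
  [/\ forall n, Lp_slab T p (vn n), Lp_slab T p w &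
    forall g, Lp_slab T q g ->
      \int[leb2]_(z in slab T) (vn n z * g z) @[n --> \oo]
        --> \int[leb2]_(z in slab T) (w z * g z)].

Definition weak_Lp_cvg T (p : R) (vn : nat -> R * R -> R) w : Prop :=
  pairing_cvg T p%:E (hoelder_conjugate p%:E) vn w.

Definition weak_star_Loo_cvg T (vn : nat -> R * R -> R) w : Prop :=
  pairing_cvg T +oo 1%E vn w.

Definition some_weak_cvg T (vn : nat -> R * R -> R) w : Prop :=
  (exists p : R, 1 <= p /\ weak_Lp_cvg T p vn w) \/ weak_star_Loo_cvg T vn w.

(* Sequences of admissible parameters: u_eps is only defined for 0 < eps <= 1. *)
Definition vanishing (eps : nat -> R) : Prop :=
  (forall n, 0 < eps n <= 1) /\ eps n @[n --> \oo] --> (0 : R).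

Definition ubar : R -> R := \1_(`]-1, 0[%classic : set R).

End Definitions.

(* Main.v *)
Require Import Defs.
From mathcomp Require Import all_boot all_order all_algebra.
From mathcomp Require Import all_classical all_reals all_analysis.
From mathcomp Require Import measurable_realfun ess_sup_inf ring lra.
Import Order.TTheory GRing.Theory Num.Theory.
Import numFieldNormedType.Exports.
Local Open Scope classical_set_scope.
Local Open Scope ring_scope.
Set Implicit Arguments.
Unset Strict Implicit.
Unset Printing Implicit Defensive.

(* Since eta vanishes on [0, +oo[, the velocity (u_eps * eta_eps)(t, x) at a
   point x >= 0 is the pairing of u_eps(t) with a test function supported in
   [x, +oo[.  Testing the equation with such functions bounds the velocity on
   x >= 0 by a multiple of its own time integral, so it vanishes (Gronwall) and
   no mass ever crosses x = 0.  Hence every weak limit w is 0 for x > 0.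

   If w also solved Burgers' equation, the mass of w in [-d, 0] could only grow,
   because the flux w^2 is nonnegative and nothing leaves at x = 0; it would
   stay >= d, and by Cauchy-Schwarz the time integral of w^2 over [-d, 0] would
   be at least of order d.  But the same equation, tested with a ramp of width
   d, bounds that integral by d times the integral of |w| over [-2d, 0], which
   is o(d). *)

(** * Smooth functions of one variable *)

Section smooth.
Context {R : realType}.
Implicit Types (f g : R -> R) (a b c x y : R).

(** The obstacle is the quadratic flux: weak convergence says nothing about the limit of
    [u_eps * (u_eps * eta_eps)], and the proof never passes to the limit in it. What survives is a
    linear constraint, vanishing on the right. It holds exactly for each fixed [eps], so the
    constants may blow up as [eps] tends to 0. The contradiction is then found inside Burgers'
    equation alone. The velocity estimate closes on itself because the velocity at [x >= 0] is a
    pairing with a translate of the kernel: the translates share one bound on the derivative and one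
    support length, and all of them stay in the right half-line. The entropy case cannot simply be
    quoted as an instance of the other one: entropy inequalities accept only nonnegative test
    functions. The Burgers argument is therefore phrased with nonnegative products of a time cutoff
    and a space profile, which both cases supply. Cauchy-Schwarz appears as Young's inequality with
    a free parameter. Every estimate is then linear in [w ^+ 2], and smallness comes from the order
    in which the parameters are fixed. *)

Fixpoint Cn (n : nat) f : Prop :=
  if n is m.+1 then (forall x, derivable f x 1) /\ Cn m (derive1 f) else continuous f.

Definition smooth f := forall n, Cn n f.

Lemma derivable_continuous f : (forall x, derivable f x 1) -> continuous f.
Proof. by move=> df x; apply/differentiable_continuous/derivable1_diffP. Qed.

Lemma smooth_derivable f x : smooth f -> derivable f x 1.
Proof. by move=> /(_ 1%N)[+ _]; exact. Qed.

Lemma smooth_continuous f : smooth f -> continuous f.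
Proof. by move=> /(_ 0%N). Qed.

Lemma smooth_derive f : smooth f -> smooth (derive1 f).
Proof. by move=> sf n; case: (sf n.+1). Qed.

Lemma smooth_primitive f g :
  (forall x, derivable f x 1) -> derive1 f = g -> smooth g -> smooth f.
Proof.
move=> df <- sg [|n]; first exact: derivable_continuous.
by split=> //; exact: sg.
Qed.

Lemma smooth_derive1n f :
  (forall n x, derivable (derive1n n f) x 1) -> smooth f.
Proof.
move=> df n; rewrite -[f]/(derive1n 0 f); elim: n 0%N => [k|n IH k] /=.
  exact: derivable_continuous.
by split => //; exact: (IH k.+1).
Qed.

Lemma smoothB f g : smooth f -> smooth g -> smooth (fun x => f x - g x).
Proof.
move=> + + n; elim: n f g => [f g sf sg x|n IH f g sf sg].
  by apply: cvgB; exact: smooth_continuous.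
split=> [x|]; first by apply: derivableB; exact: smooth_derivable.
rewrite (_ : derive1 _ = fun x => derive1 f x - derive1 g x); last first.
  apply/funext => x; rewrite !derive1E deriveB//; exact: smooth_derivable.
by apply: IH; exact: smooth_derive.
Qed.

(** The shape [c * f (a * x + b)] is stable under differentiation, so smoothness follows by
    induction. Later dilations and reflections are written literally in this shape, even when
    [c = 1] or [b = 0]. *)
Lemma derive_affine f a b c x : smooth f ->
  is_derive x 1 (fun x => c * f (a * x + b)) (c * a * derive1 f (a * x + b)).
Proof.
move=> sf; have dx : is_derive x 1 (fun x => a * x + b) a.
  by apply: is_derive_eq; rewrite addr0 /GRing.scale/= mulr1.
have df : is_derive (a * x + b) 1 f (derive1 f (a * x + b)).
  by rewrite derive1E; apply/derivableP/smooth_derivable.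
have := @is_derive1_comp _ f (fun x => a * x + b) x _ _ df dx => dfx.
rewrite (_ : c * a * _ = c *: (derive1 f (a * x + b) * a)); last first.
  by rewrite /GRing.scale/=; ring.
rewrite (_ : (fun x => _) = c \*: (f \o (fun x => a * x + b))); last exact/funext.
exact: is_deriveZ.
Qed.

Lemma derive1_affine f a b c x : smooth f ->
  derive1 (fun x => c * f (a * x + b)) x = c * a * derive1 f (a * x + b).
Proof. by move=> sf; rewrite derive1E; have [_ ->] := derive_affine a b c x sf. Qed.

Lemma smooth_affine f a b c : smooth f -> smooth (fun x => c * f (a * x + b)).
Proof.
move=> + n; elim: n f c => [f c sf x|n IH f c sf].
  have [df _] := derive_affine a b c x sf.
  by apply/differentiable_continuous/derivable1_diffP.
split=> [x|]; first by have [] := derive_affine a b c x sf.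
rewrite (_ : derive1 _ = fun x => (c * a) * derive1 f (a * x + b)).
  exact/IH/smooth_derive.
by apply/funext => x; rewrite derive1_affine.
Qed.

(** Vanishing at the endpoints themselves is included, so boundary terms of integrals drop out. For
    [b <= a] the function is zero. *)
Definition supported a b f := forall x : R, (x <= a) || (b <= x) -> f x = 0.

(** Off the closed interval the derivative vanishes by locality; at the two endpoints it vanishes by
    continuity, which is the role of [zero]. *)
Lemma supported_derive a b f : supported a b f -> smooth f -> supported a b (derive1 f).
Proof.
move=> sf smf.
have zero (h : R -> R) : continuous h -> (forall x, (x < a) || (b < x) -> h x = 0) ->
    supported a b h.
  move=> ch h0 x xab; apply/eqP/contraT => hx0.
  have /cvgrPdist_lt /(_ `|h x|) := ch x.
  rewrite normr_gt0 => /(_ hx0)[e /= e0 he].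
  have [y [xy yab]] : exists y, ball x e y /\ ((y < a) || (b < y)).
    have e2 : 0 < e / 2 by rewrite divr_gt0.
    case/orP: xab => xab; [exists (x - e / 2)|exists (x + e / 2)]; split.
    + by rewrite /ball/= opprD opprK addrA subrr add0r gtr0_norm//; lra.
    + by apply/orP; left; lra.
    + by rewrite /ball/= opprD addrA subrr add0r normrN gtr0_norm//; lra.
    + by apply/orP; right; lra.
  by have := he _ xy; rewrite (h0 y)// subr0 ltxx.
apply: zero; first exact/smooth_continuous/smooth_derive.
move=> x xab; rewrite derive1E (@near_eq_derive _ _ _ f (cst 0)) ?derive_cst//.
case/orP: xab => xab.
  have := @near_in_itvNyo R a x; rewrite in_itv/= => /(_ xab).
  by apply: filterS => y; rewrite in_itv/= => /ltW ya; apply: sf; rewrite ya.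
have := @near_in_itvoy R b x; rewrite in_itv/= andbT => /(_ xab).
by apply: filterS => y; rewrite in_itv/= andbT => /ltW yb; apply: sf; rewrite yb orbT.
Qed.

Lemma supported_bounded a b f : supported a b f -> continuous f ->
  exists2 C : R, 0 < C & forall x : R, `|f x| <= C.
Proof.
move=> sf cf; have [ab|ab] := leP a b; last first.
  exists 1 => // x; rewrite sf ?normr0//; have [/ltW->//|bx/=] := ltP x a.
  by rewrite (le_trans _ bx) ?orbT// ltW.
have [c _ fc] := @EVT_max R (fun x => `|f x|) a b ab
  (continuous_subspaceT (fun x => cvg_norm (cf x))).
exists (`|f c| + 1); first by rewrite ltr_wpDl.
move=> x; have [|xab] := boolP ((x <= a) || (b <= x)).
  by move=> /sf->; rewrite normr0 addr_ge0.
rewrite (le_trans (fc x _)) ?lerDl// in_itv/=.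
by move: xab; rewrite negb_or -!ltNge => /andP[/ltW-> /ltW->].
Qed.

Lemma supported_integrable a b f : supported a b f -> continuous f ->
  leb1.-integrable setT (EFin \o f).
Proof.
move=> sf cf; suff: leb1.-integrable setT ((EFin \o f) \_ `[a, b]).
  apply: eq_integrable => // x _ /=; rewrite patchE; case: ifPn => //.
  rewrite notin_setE/= in_itv/= => /negP; rewrite negb_and -!ltNge => xab.
  by rewrite sf//; case/orP: xab => /ltW->; rewrite ?orbT.
rewrite -integrable_mkcond//.
apply: continuous_compact_integrable; first exact: segment_compact.
exact: continuous_subspaceT.
Qed.

End smooth.

(** * Primitives and tensor products of test functions *)

Section primitive.
Context {R : realType}.
Implicit Types (f g : R -> R) (a b c x y : R).

Definition primitive f x := \int[leb1]_(t in `]-oo, x]) f t.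

Lemma is_derive_primitive a b f x : supported a b f -> continuous f ->
  derivable (primitive f) x 1 /\ derive1 (primitive f) x = f x.
Proof.
move=> sf cf; apply: (@continuous_FTC1 _ f -oo%O x (x + 1)) => //.
- by rewrite ltrDl.
- by apply: integrableS (supported_integrable sf cf).
- exact: ltNyr.
- exact: cf.
Qed.

Lemma derive1_primitive a b f : supported a b f -> continuous f ->
  derive1 (primitive f) = f.
Proof. by move=> sf cf; apply/funext => x; case: (is_derive_primitive x sf cf). Qed.

Lemma smooth_primitive_int a b f : supported a b f -> smooth f ->
  smooth (primitive f).
Proof.
move=> sf smf; apply: (smooth_primitive _ _ smf) => [x|].
  by have [] := is_derive_primitive x sf (smooth_continuous smf).
exact: derive1_primitive sf (smooth_continuous smf).
Qed.

Lemma primitive_le a b f x : supported a b f -> x <= a -> primitive f x = 0.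
Proof.
move=> sf xa; rewrite /primitive Rintegral_mkcond [LHS](_ : _ = \int[leb1]_x (cst 0 x)).
  by rewrite Rintegral_cst// mul0r.
apply: eq_Rintegral => t _; rewrite patchE; case: ifPn => // /[!inE]/= /[!in_itv]/= tx.
by rewrite sf// (le_trans tx xa).
Qed.

Lemma primitive_ge a b f x : supported a b f -> b <= x ->
  primitive f x = \int[leb1]_x f x.
Proof.
move=> sf bx; rewrite /primitive Rintegral_mkcond.
apply: eq_Rintegral => t _; rewrite patchE; case: ifPn => //.
rewrite notin_setE/= in_itv/= => /negP; rewrite -ltNge => xt.
by rewrite sf// (le_trans bx (ltW xt)) orbT.
Qed.

Lemma primitive_ndecr a b f x y : supported a b f -> continuous f ->
  (forall x, 0 <= f x) -> x <= y -> primitive f x <= primitive f y.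
Proof.
move=> sf cf f0 xy; have fi := supported_integrable sf cf.
have fii z : leb1.-integrable setT (EFin \o (f \_ `]-oo, z])).
  by rewrite -restrict_EFin -integrable_mkcond//; exact: integrableS fi.
rewrite /primitive [leLHS]Rintegral_mkcond [leRHS]Rintegral_mkcond le_Rintegral// => t _.
rewrite !patchE; case: ifPn => tx; case: ifPn => ty//.
by move: tx ty; rewrite !(inE, notin_setE)/= !in_itv/= => tx []; exact: le_trans xy.
Qed.

Lemma primitive_ge0 f x : (forall x, 0 <= f x) -> 0 <= primitive f x.
Proof. by move=> f0; apply: Rintegral_ge0 => t _; exact: f0. Qed.

Lemma primitive_le_int a b f x : supported a b f -> continuous f ->
  (forall x, 0 <= f x) -> primitive f x <= \int[leb1]_x f x.
Proof.
move=> sf cf f0; rewrite -(@primitive_ge a b f (Num.max x b))// ?le_max ?lexx ?orbT//.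
by rewrite (primitive_ndecr sf cf f0)// le_max lexx.
Qed.

End primitive.

Section tensor.
Context {R : realType}.
Implicit Types (f g : R -> R) (T : \bar R) (z : R * R).

(** These products are the only test functions of the proof; they reduce smoothness in the plane to
    one variable. *)
Definition tensor f g : R * R -> R := fun z => f z.1 * g z.2.

Lemma is_derive_tensor1 f g z : derivable f z.1 1 ->
  is_derive z ((1, 0) : R * R) (tensor f g) (derive1 f z.1 * g z.2).
Proof.
move=> df.
have lim : h^-1 *: ((tensor f g \o shift z) (h *: ((1, 0) : R * R)) - tensor f g z)
    @[h --> 0^'] --> derive1 f z.1 * g z.2.
  rewrite [X in X @ _](_ : _ = fun h =>
     (h^-1 *: ((f \o shift z.1) (h *: 1) - f z.1)) * g z.2).
    by apply: cvgMr_tmp; rewrite derive1E; exact: df.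
  apply/funext => h; rewrite /tensor /= /GRing.scale/= mulr0 add0r; ring.
apply: DeriveDef; first by apply/cvg_ex; eexists; exact: lim.
by apply: cvg_lim lim; exact: Rhausdorff.
Qed.

Lemma is_derive_tensor2 f g z : derivable g z.2 1 ->
  is_derive z ((0, 1) : R * R) (tensor f g) (f z.1 * derive1 g z.2).
Proof.
move=> dg.
have lim : h^-1 *: ((tensor f g \o shift z) (h *: ((0, 1) : R * R)) - tensor f g z)
    @[h --> 0^'] --> f z.1 * derive1 g z.2.
  rewrite [X in X @ _](_ : _ = fun h =>
     f z.1 * (h^-1 *: ((g \o shift z.2) (h *: 1) - g z.2))).
    by apply: cvgMl_tmp; rewrite derive1E; exact: dg.
  apply/funext => h; rewrite /tensor /= /GRing.scale/= mulr0 add0r; ring.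
apply: DeriveDef; first by apply/cvg_ex; eexists; exact: lim.
by apply: cvg_lim lim; exact: Rhausdorff.
Qed.

Lemma dt_tensor f g : smooth f -> dt (tensor f g) = tensor (derive1 f) g.
Proof.
move=> sf; apply/funext => z; rewrite /dt.
by have [_ ->] := is_derive_tensor1 g (@smooth_derivable _ f z.1 sf).
Qed.

Lemma dx_tensor f g : smooth g -> dx (tensor f g) = tensor f (derive1 g).
Proof.
move=> sg; apply/funext => z; rewrite /dx.
by have [_ ->] := is_derive_tensor2 f (@smooth_derivable _ g z.2 sg).
Qed.

Lemma continuous_tensor f g : continuous f -> continuous g -> continuous (tensor f g).
Proof.
move=> cf cg z; apply: cvgM.
- by apply: (@continuous_comp _ _ _ fst f); [exact: cvg_fst|exact: cf].
- by apply: (@continuous_comp _ _ _ snd g); [exact: cvg_snd|exact: cg].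
Qed.

Lemma Ck_tensor n f g : smooth f -> smooth g -> Ck n (tensor f g).
Proof.
elim: n f g => [|n IH] f g sf sg; have ct := continuous_tensor (smooth_continuous sf) (smooth_continuous sg).
  by [].
split=> //; split.
- by move=> z; have [] := is_derive_tensor1 g (@smooth_derivable _ f z.1 sf).
- by move=> z; have [] := is_derive_tensor2 f (@smooth_derivable _ g z.2 sg).
- by rewrite dt_tensor//; apply: IH => //; exact: smooth_derive.
- by rewrite dx_tensor//; apply: IH => //; exact: smooth_derive.
Qed.

(** The support may reach into negative times, which lets a test function equal 1 at [t = 0] and so
    see the initial datum; [b < T] keeps it inside the open domain. *)
Lemma test_function_tensor T a b c d f g : smooth f -> smooth g ->
  supported a b f -> supported c d g -> (b%:E < T)%E ->
  test_function T (tensor f g).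
Proof.
move=> sf sg fab gcd bT; split=> [n|]; first exact: Ck_tensor.
exists (`[a, b] `*` `[c, d]); split.
- by apply: compact_setX; exact: segment_compact.
- by move=> [t x] [/=]; rewrite in_itv/= => /andP[_ tb] _; rewrite (le_lt_trans _ bT)// lee_fin.
- move=> [t x] /not_andP; rewrite /= !in_itv/= => -[] /negP; rewrite negb_and -!ltNge => tx.
  + by rewrite /tensor/= fab ?mul0r//; case/orP: tx => /ltW->; rewrite ?orbT.
  + by rewrite /tensor/= gcd ?mulr0//; case/orP: tx => /ltW->; rewrite ?orbT.
Qed.

End tensor.

(** * Convolution and measurability *)

Section measure_tools.
Context {R : realType}.
Implicit Types (f g k : R -> R) (v : R * R -> R) (a b c x y : R).

Lemma lebesgue_measure_reflect x (A : set R) : measurable A ->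
  pushforward leb1 ((fun y => x - y) : _ -> measurableTypeR R) A = leb1 A.
Proof.
have mphi : measurable_fun setT ((fun y => x - y) : R -> measurableTypeR R).
  exact: measurable_funB.
move=> mA; apply/esym.
rewrite (@lebesgue_measure_unique _ (pushforward leb1 ((fun y => x - y) : R -> measurableTypeR R)))//= => _ [[a b]] _ <-.
rewrite /pushforward (_ : _ @^-1` _ = `[x - b, x - a[%classic).
  rewrite !lebesgue_measure_itv/= !lte_fin -EFinB.
  rewrite ltrD2l ltrN2; case: ifP => // _; congr EFin; ring.
apply/seteqP; split => y /=; rewrite !in_itv/= => /andP[]; lra.
Qed.

(** Positive and negative parts reduce this to nonnegative functions, where it is the pushforward
    formula for a reflection. *)
Lemma integral_reflect (f : R -> \bar R) x : measurable_fun setT f ->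
  (\int[leb1]_y f (x - y)%R = \int[leb1]_y f y)%E.
Proof.
pose phi : measurableTypeR R -> measurableTypeR R := fun y => x - y.
have mphi : measurable_fun setT phi by exact: measurable_funB.
have key (h : measurableTypeR R -> \bar R) : measurable_fun setT h -> (forall y, 0 <= h y)%E ->
    (\int[leb1]_y h (x - y)%R = \int[leb1]_y h y)%E.
  move=> mh h0.
  have := @ge0_integral_pushforward _ _ _ _ R phi mphi lebesgue_measure setT h
    measurableT mh (fun y _ => h0 y).
  rewrite preimage_setT => <-; apply: eq_measure_integral => A mA _.
  exact: lebesgue_measure_reflect.
move=> mf; rewrite [LHS]integralE [RHS]integralE; congr (_ - _)%E.
- by under eq_integral do rewrite (funepos_comp f (fun y => x - y));
    apply: (key f^\+%E) => //; exact: measurable_funepos.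
- by under eq_integral do rewrite (funeneg_comp f (fun y => x - y));
    apply: (key f^\-%E) => //; exact: measurable_funeneg.
Qed.

Lemma continuous_measurable f : continuous f -> measurable_fun setT f.
Proof. exact: continuous_measurable_fun. Qed.

Lemma conv_xE v k t x : measurable_fun setT (fun z => v (t, z)) -> continuous k ->
  conv_x v k (t, x) = \int[leb1]_z (v (t, z) * k (x - z)).
Proof.
move=> mv ck; rewrite /conv_x/= /Rintegral; congr fine.
rewrite -[RHS](@integral_reflect _ x); last first.
  apply/measurable_EFinP/measurable_funM => //.
  apply: (@measurableT_comp _ _ _ _ _ _ k); first exact: continuous_measurable.
  exact: measurable_funB.
by apply: eq_integral => y _; rewrite subKr.
Qed.

(** By Tonelli the section integrals of the positive and negative parts are measurable in [z];
    [fine] of their difference stays measurable even where the convolution integral diverges. *)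
Lemma measurable_conv_x v k : measurable_fun setT v -> continuous k ->
  measurable_fun setT (conv_x v k).
Proof.
move=> mv ck.
pose f (p : (R * R) * R) : \bar R := (v (p.1.1, p.1.2 - p.2) * k p.2)%:E.
have mf : measurable_fun setT f.
  apply/measurable_EFinP/measurable_funM.
    apply: (@measurableT_comp _ _ _ _ _ _ v) => //.
    apply/measurable_fun_pairP; split => /=.
      exact: (measurableT_comp measurable_fst measurable_fst).
    apply: measurable_funB; last exact: measurable_snd.
    exact: (measurableT_comp measurable_snd measurable_fst).
  apply: (@measurableT_comp _ _ _ _ _ _ k); first exact: continuous_measurable.
  exact: measurable_snd.
rewrite /conv_x /Rintegral.
apply: measurableT_comp => //.
rewrite (_ : (fun z => _) = (fun z => \int[leb1]_y f^\+ (z, y) - \int[leb1]_y f^\- (z, y))%E).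
  apply: emeasurable_funB.
  - apply: (@measurable_fun_fubini_tonelli_F _ _ _ _ _ lebesgue_measure f^\+%E).
      exact: measurable_funepos.
    by [].
  - apply: (@measurable_fun_fubini_tonelli_F _ _ _ _ _ lebesgue_measure f^\-%E).
      exact: measurable_funeneg.
    by [].
apply/funext => z; rewrite integralE.
by under eq_integral do rewrite (funepos_comp f (pair z));
  under [X in (_ - X)%E = _]eq_integral do rewrite (funeneg_comp f (pair z)).
Qed.

Lemma measurable_tensor f g : continuous f -> continuous g ->
  measurable_fun setT (tensor f g).
Proof.
move=> cf cg; apply: measurable_funM.
- by apply: (@measurableT_comp _ _ _ _ _ _ f); [exact: continuous_measurable|exact: measurable_fst].
- by apply: (@measurableT_comp _ _ _ _ _ _ g); [exact: continuous_measurable|exact: measurable_snd].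
Qed.

Lemma slabE (T : R) : slab T%:E = `[0, T]%classic `*` setT.
Proof.
by apply/seteqP; split=> -[t x]; rewrite /slab/= in_itv/= lee_fin;
  [move=> [-> ->]|move=> [/andP[]]].
Qed.

Lemma slabyE : slab +oo%E = `[(0:R), +oo[%classic `*` setT.
Proof.
apply/seteqP; split=> -[t x]; rewrite /slab/= in_itv/= andbT ?leey; by case.
Qed.

Lemma measurable_slab (T : \bar R) : (0 <= T)%E -> measurable (slab T).
Proof.
case: T => [T _||//]; first by rewrite slabE; exact: measurableX.
by rewrite slabyE => _; exact: measurableX.
Qed.

End measure_tools.

(** * Smooth plateaus *)

Section plateau.
Context {R : realType}.
Variable eta : R -> R.
Hypothesis eta_kernel : convolution_kernel eta.
Hypothesis eta_ge0 : forall x : R, 0 <= x -> eta x = 0.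
Implicit Types (a b r t x : R).

Lemma smooth_eta : smooth eta.
Proof. by case: eta_kernel => ? _ _ _; exact: smooth_derive1n. Qed.

Let eta_nneg x : 0 <= eta x. Proof. by case: eta_kernel. Qed.

Lemma supported_eta : supported (-1) 0 eta.
Proof.
move=> x /orP[x1|/eta_ge0//]; case: eta_kernel => _ + _ _; apply.
by rewrite ler0_norm; lra.
Qed.

Lemma smooth_rescale (eps : R) : smooth (rescale eps eta).
Proof.
rewrite (_ : rescale eps eta = fun x => eps^-1 * eta (eps^-1 * x + 0)).
  exact: (smooth_affine _ _ _ smooth_eta).
by apply/funext => x; rewrite /rescale addr0 [x / _]mulrC.
Qed.

Lemma supported_rescale (eps : R) : 0 < eps <= 1 -> supported (-1) 0 (rescale eps eta).
Proof.
move=> /andP[e0 e1] x x01; rewrite /rescale supported_eta ?mulr0//.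
case/orP: x01 => [xl|xr]; apply/orP; [left|right].
  by rewrite ler_pdivrMr//; lra.
by rewrite divr_ge0//; lra.
Qed.

(** It climbs from 0 at [-1] to 1 at [0], so the kernel itself supplies all smooth cutoffs. *)
Definition step : R -> R := primitive eta.

Lemma smooth_step : smooth step.
Proof. exact (smooth_primitive_int supported_eta smooth_eta). Qed.

Let ceta : continuous eta. Proof. exact: smooth_continuous smooth_eta. Qed.

Lemma derive1_step : derive1 step = eta.
Proof. exact: derive1_primitive supported_eta ceta. Qed.

Lemma step0 x : x <= -1 -> step x = 0.
Proof. exact: primitive_le supported_eta. Qed.

Lemma step1 x : 0 <= x -> step x = 1.
Proof. by case: eta_kernel => _ _ _ <-; exact: primitive_ge supported_eta. Qed.

Lemma step_ge0 x : 0 <= step x.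
Proof. exact: primitive_ge0. Qed.

Lemma step_le1 x : step x <= 1.
Proof.
by case: eta_kernel => _ _ _ <-; exact: primitive_le_int supported_eta ceta _.
Qed.

Lemma step_ndecr x y : x <= y -> step x <= step y.
Proof. exact: primitive_ndecr supported_eta ceta _. Qed.

(** For [a <= b - r]: up on [[a - r, a]], equal to 1 on [[a, b - r]], down on [[b - r, b]]. Both
    ramps end at their parameter because [eta] lives on [[-1, 0]]. *)
Definition plateau a b r t := step ((t - a) / r) - step ((t - b) / r).

Let plateauE a b r : plateau a b r =
  fun t => 1 * step (r^-1 * t + - a / r) - 1 * step (r^-1 * t + - b / r).
Proof.
by apply/funext => t; rewrite /plateau !mul1r !mulrDl [t / r]mulrC.
Qed.

Lemma smooth_plateau a b r : smooth (plateau a b r).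
Proof. by rewrite plateauE; apply: smoothB; exact: (smooth_affine _ _ _ smooth_step). Qed.

Lemma derive1_plateau a b r t : derive1 (plateau a b r) t =
  r^-1 * eta ((t - a) / r) - r^-1 * eta ((t - b) / r).
Proof.
rewrite plateauE derive1E deriveB; [|exact: smooth_derivable (smooth_affine _ _ _ smooth_step)..].
rewrite -!derive1E !(derive1_affine _ _ _ _ smooth_step) derive1_step !mul1r.
by rewrite !mulrDl [t / r]mulrC.
Qed.

Let ramp0 r t : 0 < r -> t <= - r -> step (t / r) = 0.
Proof. by move=> r0 tr; apply: step0; rewrite ler_pdivrMr//; lra. Qed.

Let ramp1 r t : 0 < r -> 0 <= t -> step (t / r) = 1.
Proof. by move=> r0 t0; apply: step1; rewrite divr_ge0// ltW. Qed.

Lemma plateau_left a b r t : 0 < r -> a <= b -> t <= a - r -> plateau a b r t = 0.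
Proof. by move=> r0 ab ta; rewrite /plateau !ramp0 ?subrr//; lra. Qed.

Lemma plateau_right a b r t : 0 < r -> a <= b -> b <= t -> plateau a b r t = 0.
Proof. by move=> r0 ab ta; rewrite /plateau !ramp1 ?subrr//; lra. Qed.

Lemma plateau_one a b r t : 0 < r -> a <= t -> t <= b - r -> plateau a b r t = 1.
Proof. by move=> r0 ta tb; rewrite /plateau ramp1 ?ramp0 ?subr0//; lra. Qed.

Lemma plateau_ge0 a b r t : 0 < r -> a <= b -> 0 <= plateau a b r t.
Proof.
move=> r0 ab; rewrite subr_ge0 step_ndecr// ler_pM2r ?invr_gt0//.
by rewrite lerD2l lerN2.
Qed.

Lemma plateau_le1 a b r t : plateau a b r t <= 1.
Proof.
rewrite /plateau; have := step_ge0 ((t - b) / r).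
by have := step_le1 ((t - a) / r); lra.
Qed.

Lemma supported_plateau a b r : 0 < r -> a <= b -> supported (a - r) b (plateau a b r).
Proof. by move=> r0 ab t /orP[ta|tb]; [exact: plateau_left|exact: plateau_right]. Qed.

Let eta_right r t : 0 < r -> 0 <= t -> eta (t / r) = 0.
Proof. by move=> r0 t0; apply: eta_ge0; rewrite divr_ge0// ltW. Qed.

Let eta_left r t : 0 < r -> t <= - r -> eta (t / r) = 0.
Proof.
by move=> r0 tr; rewrite supported_eta//; apply/orP; left; rewrite ler_pdivrMr//; lra.
Qed.

Lemma derive1_plateau_le0 a b r t : 0 < r -> a <= t -> derive1 (plateau a b r) t <= 0.
Proof.
move=> r0 ta; rewrite derive1_plateau eta_right ?subr_ge0//.
by rewrite mulr0 sub0r oppr_le0 mulr_ge0// invr_ge0 ltW.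
Qed.

Lemma derive1_plateau_eq0 a b r t : 0 < r -> a <= t -> t <= b - r ->
  derive1 (plateau a b r) t = 0.
Proof.
move=> r0 ta tb; rewrite derive1_plateau eta_right ?subr_ge0// eta_left//; last by lra.
by rewrite mulr0 subrr.
Qed.

Lemma derive1_plateau_ge0 a b r t : 0 < r -> t <= b - r ->
  0 <= derive1 (plateau a b r) t.
Proof.
move=> r0 tb; rewrite derive1_plateau [eta ((t - b) / r)]eta_left//; last by lra.
by rewrite mulr0 subr0 mulr_ge0// invr_ge0 ltW.
Qed.

End plateau.

(** * Integral estimates *)

Lemma integrable_mul_bounded {R : realType} d (X : measurableType d)
    (mu : {measure set X -> \bar R}) (D : set X) (f g : X -> R) (C : R) :
  measurable D -> mu.-integrable D (EFin \o f) -> measurable_fun D g ->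
  (forall x, D x -> `|g x| <= C) -> mu.-integrable D (EFin \o (fun x => f x * g x)).
Proof.
move=> mD fi mg gC.
apply: (@le_integrable _ _ _ _ _ mD _ (EFin \o (fun x => f x * C))).
- apply/measurable_EFinP/measurable_funM => //.
  exact/measurable_EFinP/(measurable_int _ fi).
- by move=> x Dx /=; rewrite lee_fin !normrM ler_wpM2l// (le_trans (gC x Dx))// ler_norm.
- rewrite (_ : EFin \o _ = (fun x => C%:E * (f x)%:E)%E); first exact: integrableZl.
  by apply/funext => x /=; rewrite EFinM muleC.
Qed.

Lemma integrable_add_EFin {R : realType} d (X : measurableType d)
    (mu : {measure set X -> \bar R}) (D : set X) (f g : X -> R) :
  measurable D -> mu.-integrable D (EFin \o f) -> mu.-integrable D (EFin \o g) ->
  mu.-integrable D (EFin \o (fun x => f x + g x)).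
Proof. by move=> mD fi gi; exact: (integrableD mD fi gi). Qed.

Lemma integrable_dominated {R : realType} d (X : measurableType d)
    (mu : {measure set X -> \bar R}) (D : set X) (f g : X -> R) :
  measurable D -> measurable_fun D f -> (forall x, D x -> `|f x| <= g x) ->
  mu.-integrable D (EFin \o g) -> mu.-integrable D (EFin \o f).
Proof.
move=> mD mf fg; apply: le_integrable => //; first exact/measurable_EFinP.
by move=> x Dx /=; rewrite lee_fin (le_trans (fg x Dx))// ler_norm.
Qed.

Section integral_bounds.
Context {R : realType}.
Implicit Types (f g h w : R -> R) (a b M D S : R).

Lemma ae_imply (P Q : R -> Prop) : (forall x, P x -> Q x) ->
  {ae leb1, forall x : R, P x} -> {ae leb1, forall x : R, Q x}.
Proof. by move=> PQ; apply: (@filterS _ _ (ae_filter_ringOfSetsType lebesgue_measure)). Qed.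

Lemma ae_imply2 (P Q S : R -> Prop) : (forall x, P x -> Q x -> S x) ->
  {ae leb1, forall x : R, P x} -> {ae leb1, forall x : R, Q x} ->
  {ae leb1, forall x : R, S x}.
Proof. by move=> PQ; apply: (@filterS2 _ _ (ae_filter_ringOfSetsType lebesgue_measure)). Qed.

Lemma Rintegral_derive1 f a b : (forall x, derivable f x 1) ->
  continuous (derive1 f) -> a < b ->
  \int[leb1]_(x in `[a, b]) derive1 f x = f b - f a.
Proof.
move=> df cf' ab; have cf := derivable_continuous df.
rewrite /Rintegral (@continuous_FTC2 _ (derive1 f) f)//.
  exact: continuous_subspaceT.
split=> [x _||].
- exact: df.
- exact/cvg_at_right_filter/cf.
- exact/cvg_at_left_filter/cf.
Qed.

(** The factor [1 / lam] gained over the integrand at [t] is what drives the weighted iteration. *)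
Lemma Rintegral_expR_le (D lam t : R) : 0 <= D -> 0 < lam -> 0 < t ->
  \int[leb1]_(s in `[0, t]) (D * expR (lam * s)) <= D / lam * expR (lam * t).
Proof.
move=> D0 lam0 t0; pose f s := D / lam * expR (lam * s).
have df (s : R) : is_derive s 1 f (D * expR (lam * s)).
  have dl : is_derive s 1 (fun s => lam * s) lam.
    by apply: is_derive_eq; rewrite /GRing.scale/= mulr1.
  have de := @is_derive1_comp _ expR (fun s => lam * s) s _ _ (is_derive_expR (lam * s)) dl.
  rewrite (_ : f = (D / lam) \*: (expR \o (fun s => lam * s))); last exact/funext.
  rewrite (_ : D * expR _ = (D / lam) *: (expR (lam * s) * lam)); first exact: is_deriveZ.
  by rewrite /GRing.scale/=; field; rewrite gt_eqF.
have f' : derive1 f = fun s => D * expR (lam * s).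
  by apply/funext => s; rewrite derive1E; have [_ ->] := df s.
rewrite -f' Rintegral_derive1//.
- by rewrite lerBlDr lerDl mulr_ge0 ?expR_ge0// divr_ge0// ltW.
- rewrite f' => s; apply: cvgMl_tmp; apply: continuous_comp; last exact: continuous_expR.
  by apply: cvgMl_tmp; exact: cvg_id.
Qed.

Lemma integral_bounded_mul_le h w a b M D : measurable_fun setT h -> measurable_fun setT w ->
  {ae leb1, forall x : R, `|h x| <= M} -> (forall x, x \notin `[a, b] -> w x = 0) ->
  (forall x, `|w x| <= D) -> a <= b ->
  (\int[leb1]_x `|(h x * w x)%:E| <= (M * D * (b - a))%:E)%E.
Proof.
move=> mh mw hM w0 wD ab.
have D0 : 0 <= D by apply: le_trans (wD 0).
pose g x : \bar R := (`|(M * D)%:E| * (\1_(`[a, b]%classic : set R) x)%:E)%E.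
have mg : measurable_fun setT g.
  apply: emeasurable_funM; first exact: measurable_cst.
  by apply/measurable_EFinP; exact: measurable_indic.
(* A negative [M] would make the almost everywhere bound fail at every point, so the whole line, and
   with it [[0, 1]], would be null. *)
have M0 : 0 <= M.
  have [//|M0] := leP 0 M; exfalso.
  have : {ae (@lebesgue_measure R), forall x : R, False}.
    by apply: ae_imply hM => x xM; have := le_lt_trans (le_trans (normr_ge0 _) xM) M0; rewrite ltxx.
  move=> [N [mN N0 /= NT]].
  have : (leb1 (`[0%R, 1%R]%classic : set R) <= leb1 N)%E.
    by apply: le_measure; rewrite ?inE// => x _; apply: NT => /=.
  by rewrite N0 lebesgue_measure_itv/= lte_fin ltr01 oppr0 adde0 lee_fin ler10.
apply: (@le_trans _ _ (\int[leb1]_x g x)%E).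
  apply: ae_ge0_le_integral => //.
  - by apply: measurableT_comp => //; apply/measurable_EFinP; exact: measurable_funM.
  - by move=> x _; rewrite mule_ge0// lee_fin.
  apply: ae_imply hM => x hxM _ /=; rewrite /g indicE.
  have [xab|xab] := boolP (x \in (`[a, b]%classic : set R)).
    rewrite mule1 abse_EFin lee_fin normrM [leRHS]normrM.
    by rewrite ler_pM ?[`|M|]ger0_norm ?[`|D|]ger0_norm.
  rewrite w0 ?mulr0 ?normr0 ?mule0//=.
  by move: xab; rewrite notin_setE/= => /negP.
rewrite /g ge0_integralZl//; last by apply/measurable_EFinP; exact: measurable_indic.
rewrite integral_indic// setIT /= lebesgue_measure_itv/= ger0_norm ?mulr_ge0//.
by rewrite lte_fin; case: ifPn => _; rewrite -EFinM// lee_fin ?mulr0 ?mulr_ge0// subr_ge0.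
Qed.

(** The solution space bounds almost every time slice for almost every [x], so integrability on the
    plane is obtained from iterated integrals, with [f] majorizing the norms of the slices. *)
Lemma tonelli_bound (G : R * R -> R) f S :
  measurable_fun setT G -> (forall t x : R, t \notin `[0, S] -> G (t, x) = 0) ->
  leb1.-integrable `[0, S] (EFin \o f) -> (forall t, 0 <= f t) ->
  {ae leb1, forall t : R, 0 <= t <= S -> (\int[leb1]_x `|(G (t, x))%:E| <= (f t)%:E)%E} ->
  leb2.-integrable setT (EFin \o G) /\
  `|\int[leb2]_z G z| <= \int[leb1]_(t in `[0, S]) f t.
Proof.
move=> mG G0 fi f0 Gf.
have mGE : measurable_fun setT (EFin \o G) by exact/measurable_EFinP.
have mf : measurable_fun setT ((EFin \o f) \_ `[0, S]).
  by apply/(measurable_restrictT _ _).1 => //; exact: measurable_int fi.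
have le : (\int[leb1]_t \int[leb1]_x `|(G (t, x))%:E| <=
           \int[leb1]_(t in `[0%R, S]) (f t)%:E)%E.
  rewrite [leRHS]integral_mkcond; apply: ae_ge0_le_integral => //.
  - by move=> t _; exact: integral_ge0.
  - apply: (@measurable_fun_fubini_tonelli_F _ _ _ _ _ lebesgue_measure
      (abse \o (EFin \o G))); first exact: measurableT_comp.
    by move=> z; exact: abse_ge0.
  - by move=> t _; rewrite patchE; case: ifPn => // _; rewrite lee_fin.
  apply: ae_imply Gf => t /= Gft _; rewrite patchE; case: ifPn => tS.
    by apply: Gft; move: tS; rewrite inE/= in_itv.
  rewrite integral0_eq// => x _; rewrite G0 ?normr0//.
  by move: tS; rewrite notin_setE/= => /negP.
have fin : (\int[leb1]_(t in `[0%R, S]) (f t)%:E < +oo)%E.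
  by apply: integrable_lty fi.
have iG : leb2.-integrable setT (EFin \o G).
  by apply/integrable12ltyP => //; exact: le_lt_trans le fin.
split=> //; rewrite -lee_fin.
apply: (@le_trans _ _ (\int[leb2]_z `|(G z)%:E|)%E).
  by rewrite /Rintegral -abse_EFin fineK; [exact: le_abse_integral|exact: integrable_fin_num].
have -> : (\int[leb2]_z `|(G z)%:E| = \int[leb1]_t \int[leb1]_x `|(G (t, x))%:E|)%E.
  apply: (@fubini_tonelli1 _ _ _ _ _ lebesgue_measure lebesgue_measure
    (abse \o (EFin \o G))); first exact: measurableT_comp.
  by move=> z; exact: abse_ge0.
by rewrite (le_trans le)// /Rintegral fineK//; exact: integrable_fin_num.
Qed.

End integral_bounds.

(** * Time slices of the nonlocal equation *)

Section time_slice.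
Context {R : realType}.
Variables (eta : R -> R) (k : R -> R) (v : R * R -> R).
Hypothesis eta_kernel : convolution_kernel eta.
Hypothesis eta_ge0 : forall x : R, 0 <= x -> eta x = 0.
Hypothesis ck : continuous k.
Hypothesis v_space : solution_space v.
Hypothesis v_sol : distributional_solution +oo (@ubar R) v (fun z => v z * conv_x v k z).

(** Extension by zero to negative times allows Fubini on the whole plane and hides the part of a
    cutoff before [t = 0]. *)
Let V : R * R -> R := v \_ (slab +oo).

Let VE (t x : R) : 0 <= t -> V (t, x) = v (t, x).
Proof. by move=> t0; rewrite /V patchE mem_set//; split=> //; rewrite leey. Qed.

Let V0 (t x : R) : t < 0 -> V (t, x) = 0.
Proof.
by move=> t0; rewrite /V patchE memNset// => -[/=]; rewrite leNgt t0.
Qed.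

Let mV : measurable_fun setT V.
Proof.
have [mv _ _ _] := v_space.
by apply/(measurable_restrictT _ _).1 => //; exact: measurable_slab.
Qed.

Let mVx t : measurable_fun setT (fun x => V (t, x)).
Proof. exact: (measurable_fun_pair2 t mV). Qed.

Let convVE (t x : R) : 0 <= t -> conv_x V k (t, x) = conv_x v k (t, x).
Proof. by move=> t0; apply: eq_Rintegral => y _ /=; rewrite VE. Qed.

Let VM_ae (T0 M : R) : {ae leb1, forall t : R, 0 <= t <= T0 -> {ae leb1, forall x : R, `|v (t, x)| <= M}} ->
  {ae leb1, forall t : R, 0 <= t <= T0 -> {ae leb1, forall x : R, `|V (t, x)| <= M}}.
Proof.
apply: ae_imply => t + tT => /(_ tT); apply: ae_imply => x.
by case/andP: tT => t0 _; rewrite VE.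
Qed.

Definition pairing (psi : R -> R) t := \int[leb1]_x (v (t, x) * psi x).

(** * Testing the nonlocal equation with a time cutoff times a space profile *)

Section slice_test.
Variables (psi : R -> R) (a b T0 M A lam C t1 d : R).
Hypothesis spsi : smooth psi.
Hypothesis psi_supp : supported a b psi.
Hypotheses (a0 : 0 <= a) (ab : a <= b) (M0 : 0 <= M) (A0 : 0 <= A) (lam0 : 0 < lam).
Hypothesis vM : {ae leb1, forall t : R, 0 <= t <= T0 ->
  {ae leb1, forall x : R, `|v (t, x)| <= M}}.
Hypothesis psiC : forall x, `|derive1 psi x| <= C.
Hypothesis conv_le : {ae leb1, forall t : R, 0 <= t <= T0 -> forall x, 0 <= x ->
  `|conv_x v k (t, x)| <= A * expR (lam * t)}.
Hypotheses (d0 : 0 < d) (dt1 : d < t1) (t1T : t1 <= T0).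

(** The upward ramp lies in negative times, outside the slab; for [t >= 0] only the downward ramp on
    [[t1 - d, t1]] contributes to [derive1 chi]. *)
Let chi := plateau eta 0 t1 d.

Let schi : smooth chi. Proof. exact: smooth_plateau. Qed.

Let chi_supp : supported (0 - d) t1 chi.
Proof. by apply: supported_plateau => //; apply: ltW; exact: lt_trans dt1. Qed.

Let G1 : R * R -> R := fun z => V z * tensor (derive1 chi) psi z.
Let G2 : R * R -> R := fun z => V z * conv_x V k z * tensor chi (derive1 psi) z.

Let outside (f : R -> R) (S : R) : supported (0 - d) S f ->
  forall t x : R, t \notin `[0, S] -> V (t, x) = 0 \/ f t = 0.
Proof.
move=> sf t x; rewrite in_itv/= negb_and -!ltNge => /orP[t0|tS].
  by left; exact: V0.
by right; apply: sf; rewrite (ltW tS) orbT.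
Qed.

Let psi_out (f : R -> R) : supported a b f -> forall x, x \notin `[a, b] -> f x = 0.
Proof.
move=> sf x; rewrite in_itv/= negb_and -!ltNge => /orP[xa|bx]; apply: sf.
  by rewrite (ltW xa).
by rewrite (ltW bx) orbT.
Qed.

Let iG1 : leb2.-integrable setT (EFin \o G1).
Proof.
have [Cp Cp0 hCp] := supported_bounded psi_supp (smooth_continuous spsi).
have cchi' := smooth_continuous (smooth_derive schi).
have [Cc Cc0 hCc] := supported_bounded (supported_derive chi_supp schi) cchi'.
apply: (@tonelli_bound R G1 (fun=> M * (Cc * Cp) * (b - a)) t1 _ _ _ _ _).1.
- apply: measurable_funM => //; apply: measurable_tensor => //; exact: smooth_continuous.
- move=> t x tt; rewrite /G1 /tensor/=.
  by have [->|->] := outside (supported_derive chi_supp schi) x tt; rewrite !(mul0r, mulr0).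
- by apply: continuous_compact_integrable;
    [exact: segment_compact|apply: continuous_subspaceT => ?; exact: cvg_cst].
- by move=> _; rewrite !mulr_ge0// ?subr_ge0// ltW.
- apply: ae_imply (VM_ae vM) => t hV /andP[t0 tt1].
  have {}hV : {ae leb1, forall x : R, `|V (t, x)| <= M}.
    by apply: hV; rewrite t0 (le_trans tt1 t1T).
  apply: (@integral_bounded_mul_le _ _ (fun x => derive1 chi t * psi x) a b) => //.
  + apply: measurable_funM => //; apply: continuous_measurable; exact: smooth_continuous.
  + by move=> x /(psi_out psi_supp)->; rewrite mulr0.
  + by move=> x; rewrite normrM ler_pM.
Qed.

Let iG2 : leb2.-integrable setT (EFin \o G2) /\
  `|\int[leb2]_z G2 z| <= \int[leb1]_(t in `[0, t1]) (M * (A * expR (lam * t) * C) * (b - a)).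
Proof.
have C0 : 0 <= C by apply: le_trans (psiC 0).
have cexp : continuous (fun t : R => M * (A * expR (lam * t) * C) * (b - a)).
  move=> t; apply: cvgMr_tmp; apply: cvgMl_tmp; apply: cvgMr_tmp; apply: cvgMl_tmp.
  apply: continuous_comp; last exact: continuous_expR.
  by apply: cvgMl_tmp; exact: cvg_id.
have mconv := measurable_conv_x mV ck.
apply: tonelli_bound.
- apply: measurable_funM; first exact: measurable_funM.
  by apply: measurable_tensor; apply: smooth_continuous => //; exact: smooth_derive.
- move=> t x tt; rewrite /G2 /tensor/=.
  by have [->|->] := outside chi_supp x tt; rewrite !(mul0r, mulr0).
- by apply: continuous_compact_integrable;
    [exact: segment_compact|apply: continuous_subspaceT].
- by move=> t; rewrite !mulr_ge0// ?subr_ge0// ?expR_ge0.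
- apply: ae_imply2 (VM_ae vM) conv_le => t hV hc /andP[t0 tt1].
  have tT : 0 <= t <= T0 by rewrite t0 (le_trans tt1 t1T).
  have -> : (fun x => `|(G2 (t, x))%:E|%E) =
      (fun x => `|(V (t, x) * (conv_x V k (t, x) * (chi t * derive1 psi x)))%:E|%E).
    by apply/funext => x; rewrite /G2 /tensor/= -mulrA.
  apply: integral_bounded_mul_le => //.
  + apply: measurable_funM; first exact: (measurable_fun_pair2 t mconv).
    apply: measurable_funM => //; apply: continuous_measurable.
    exact/smooth_continuous/smooth_derive.
  + exact: hV.
  + by move=> x /(psi_out (supported_derive psi_supp spsi))->; rewrite !mulr0.
  (* The velocity bound is available for [x >= 0] only: on [[a, b]] it applies because [0 <= a], and
     outside the factor [derive1 psi] vanishes. *)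
  + move=> x; have [xab|/(psi_out (supported_derive psi_supp spsi))->] := boolP (x \in `[a, b]).
      rewrite normrM ler_pM//.
        by rewrite convVE// hc//; move: xab; rewrite in_itv/= => /andP[/(le_trans a0)].
      rewrite normrM -[leRHS]mul1r ler_pM// ger0_norm.
        exact: plateau_le1.
      by apply: plateau_ge0 => //; apply: ltW; exact: lt_trans dt1.
    by rewrite !mulr0 normr0 !mulr_ge0// expR_ge0.
Qed.

Let V_pairing t : \int[leb1]_x (V (t, x) * (derive1 chi t * psi x)) =
  ((fun t => derive1 chi t * pairing psi t) \_ `[t1 - d, t1]) t.
Proof.
have t1d : 0 <= t1 - d by rewrite subr_ge0 ltW.
have zero (c : R -> R) : (forall x, c x = 0) -> \int[leb1]_x c x = 0.
  by move=> c0; rewrite (eq_Rintegral _ (g := cst 0)) ?Rintegral_cst ?mul0r// => x _; rewrite c0.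
rewrite patchE; case: ifPn.
  rewrite inE/= in_itv/= => /andP[tl tr]; have t0 := le_trans t1d tl.
  rewrite /pairing -RintegralZl//.
    by apply: eq_Rintegral => x _; rewrite VE// mulrCA.
  have [_ _ vi _] := v_space.
  have [Cp Cp0 hCp] := supported_bounded psi_supp (smooth_continuous spsi).
  apply: (@integrable_mul_bounded _ _ _ _ _ _ _ Cp) => //.
  - exact: vi.
  - exact: (continuous_measurable (smooth_continuous spsi)).
rewrite notin_setE/= in_itv/= => /negP; rewrite negb_and -!ltNge => tout.
apply: zero => x; have [t0|t0] := ltP t 0; first by rewrite V0 ?mul0r.
case/orP: tout => tt; last first.
  rewrite (supported_derive chi_supp schi) ?mul0r ?mulr0// (ltW tt) orbT//.
by rewrite derive1_plateau_eq0 ?mul0r ?mulr0// ltW.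
Qed.

(** The time term and the flux term of the tested equation cancel: the datum contributes nothing,
    since [psi] lives in [x >= 0] and [ubar] in [x < 0]. Fubini rewrites the time term as the
    integral on the left. *)
Lemma slice_bound :
  leb1.-integrable `[t1 - d, t1] (EFin \o (fun t => derive1 chi t * pairing psi t)) /\
  `|\int[leb1]_(t in `[t1 - d, t1]) (derive1 chi t * pairing psi t)| <=
  \int[leb1]_(t in `[0, t1]) (M * (A * expR (lam * t) * C) * (b - a)).
Proof.
have [i2 b2] := iG2.
have sect t : (\int[leb1]_x (G1 (t, x))%:E =
    (((fun t => derive1 chi t * pairing psi t) \_ `[t1 - d, t1]) t)%:E)%E.
  rewrite -V_pairing /Rintegral fineK//.
  apply: integrable_fin_num => //.
  have [t0|t0] := ltP t 0.
    rewrite (_ : (fun x => _) = cst 0%E); first exact: integrable0.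
    by apply/funext => x; rewrite V0 ?mul0r.
  have [_ _ vi _] := v_space.
  have [Cp Cp0 hCp] := supported_bounded psi_supp (smooth_continuous spsi).
  rewrite (_ : (fun x => _) = EFin \o (fun x => v (t, x) * (derive1 chi t * psi x))); last first.
    by apply/funext => x; rewrite VE.
  apply: (@integrable_mul_bounded _ _ _ _ _ _ _ (`|derive1 chi t| * Cp)) => //.
  - exact: vi.
  - by apply: measurable_funM => //; exact: (continuous_measurable (smooth_continuous spsi)).
  - by move=> x _; rewrite normrM ler_wpM2l.
have EG1 : \int[leb2]_z G1 z =
    \int[leb1]_(t in `[t1 - d, t1]) (derive1 chi t * pairing psi t).
  rewrite [RHS]Rintegral_mkcond /Rintegral; congr fine.
  rewrite -(integral12_prod_meas1 iG1).
  by apply: eq_integral => t _; exact: sect.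
split.
  apply/integrable_mkcond => //; rewrite restrict_EFin.
  have := integrable_fubini_F iG1.
  apply: eq_integrable => // t _; exact: sect.
rewrite -EG1; suff : \int[leb2]_z G1 z + \int[leb2]_z G2 z = 0.
  by move=> /eqP; rewrite addr_eq0 => /eqP->; rewrite normrN.
rewrite -RintegralD//.
have := v_sol (@test_function_tensor _ _ _ _ _ _ chi psi schi spsi chi_supp psi_supp (ltry t1)).
rewrite [X in _ + X](_ : _ = 0); last first.
  rewrite (eq_Rintegral _ (g := cst 0)) ?Rintegral_cst ?mul0r// => x _.
  rewrite /tensor/= /ubar indicE; have [xa|ax] := leP x a.
    by rewrite (psi_supp (x := x)) ?xa// mulr0 mul0r.
  rewrite memNset ?mulr0//= in_itv/= => /andP[_ x0].
  by have := lt_le_trans x0 (le_trans a0 (ltW ax)); rewrite ltxx.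
rewrite addr0 (dt_tensor psi schi) (dx_tensor chi spsi) Rintegral_mkcond => <-.
apply: eq_Rintegral => -[t x] _; rewrite patchE; case: ifPn => [|tn].
  rewrite inE => -[/= t0 _]; rewrite /G1 /G2 !VE// convVE//.
rewrite /G1 /G2 V0 ?mul0r ?addr0// ltNge; apply/negP => t0.
by move: tn; rewrite notin_setE; apply; split=> //; rewrite leey.
Qed.

End slice_test.

Lemma pairing_continuous (psi : R -> R) (a b t1 e : R) : continuous psi ->
  supported a b psi -> 0 <= t1 -> 0 < e ->
  exists2 d : R, 0 < d & forall s : R, 0 <= s -> `|s - t1| < d ->
    `|pairing psi s - pairing psi t1| <= e.
Proof.
move=> cpsi psi_supp t10 e0; have [_ _ vi vc] := v_space.
have [Cp Cp0 hCp] := supported_bounded psi_supp cpsi.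
have mpsi := continuous_measurable cpsi.
have /cvgrPdist_lt /(_ _ (divr_gt0 e0 Cp0)) [d /= d0 hd] := vc t1 t10.
exists d => // s s0 st; have := hd s; rewrite /ball/= distrC => /(_ st s0).
have ivpsi t : 0 <= t -> leb1.-integrable setT (EFin \o (fun x => v (t, x) * psi x)).
  by move=> t0; apply: (integrable_mul_bounded _ (vi t t0) mpsi (C := Cp)).
have idiff : leb1.-integrable setT (EFin \o (fun x => `|v (s, x) - v (t1, x)|)).
  by apply: integrable_norm; exact: (integrableB _ (vi s s0) (vi t1 t10)).
rewrite sub0r normrN ger0_norm; last by apply: Rintegral_ge0.
rewrite ltr_pdivlMr// => /ltW; apply: le_trans.
rewrite /pairing -RintegralB//; [|exact: ivpsi..].
apply: (le_trans (le_normr_Rintegral _ _)) => //.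
  exact: (integrableB _ (ivpsi s s0) (ivpsi t1 t10)).
rewrite -RintegralZr//; apply: le_Rintegral => //.
- by apply: integrable_norm; exact: (integrableB _ (ivpsi s s0) (ivpsi t1 t10)).
- by apply: (@integrable_mul_bounded _ _ _ _ _ _ _ `|Cp|).
- by move=> x _; rewrite -mulrBl normrM ler_wpM2l.
Qed.

(** As [d] shrinks, [- derive1 chi] is a density of mass 1 concentrating at [t1], so the averaged
    bound of [slice_bound] becomes a bound at time [t1]; continuity in time with values in L^1
    controls the error [e]. *)
Lemma pairing_le (psi : R -> R) (a b T0 M A lam C t1 : R) :
  smooth psi -> supported a b psi -> 0 <= a -> a <= b -> 0 <= M -> 0 <= A -> 0 < lam ->
  {ae leb1, forall t : R, 0 <= t <= T0 -> {ae leb1, forall x : R, `|v (t, x)| <= M}} ->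
  (forall x, `|derive1 psi x| <= C) ->
  {ae leb1, forall t : R, 0 <= t <= T0 -> forall x, 0 <= x ->
    `|conv_x v k (t, x)| <= A * expR (lam * t)} ->
  0 < t1 <= T0 ->
  `|pairing psi t1| <= M * C * (b - a) * A / lam * expR (lam * t1).
Proof.
move=> spsi psi_supp a0 ab M0 A0 lam0 vM psiC conv_le /andP[t10 t1T].
have C0 : 0 <= C by apply: le_trans (psiC 0).
apply/ler_addgt0Pr => e e0.
have [d' d'0 hd'] := pairing_continuous (smooth_continuous spsi) psi_supp (ltW t10) e0.
pose d := Num.min (d' / 2) (t1 / 2).
have d0 : 0 < d by rewrite lt_min !divr_gt0.
have dt1 : d < t1.
  by rewrite (@le_lt_trans _ _ (t1 / 2))// ?ge_min ?lexx ?orbT//; lra.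
have dd' : d < d'.
  by rewrite (@le_lt_trans _ _ (d' / 2))// ?ge_min ?lexx//; lra.
have [ichi] := slice_bound spsi psi_supp a0 ab M0 A0 vM psiC conv_le d0 dt1 t1T.
set chi := plateau eta 0 t1 d; set I := \int[leb1]_(t in _) _ => bI.
have schi : smooth chi by exact: smooth_plateau.
have cchi' := smooth_continuous (smooth_derive schi).
have ichi' : leb1.-integrable `[t1 - d, t1] (EFin \o derive1 chi).
  by apply: continuous_compact_integrable; [exact: segment_compact|exact: continuous_subspaceT].
have td : t1 - d < t1 by rewrite ltrBlDr ltrDl.
have chi1 : \int[leb1]_(t in `[t1 - d, t1]) derive1 chi t = -1.
  rewrite (Rintegral_derive1 (fun x => @smooth_derivable _ chi x schi) cchi' td).
  have -> : chi t1 = 0 by apply: plateau_right => //; exact: ltW.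
  have -> : chi (t1 - d) = 1 by apply: plateau_one => //; rewrite subr_ge0 ltW.
  by rewrite sub0r.
have chi'0 t : t \in `[t1 - d, t1] -> derive1 chi t <= 0.
  by rewrite in_itv/= => /andP[tl _]; apply: derive1_plateau_le0 => //; apply: le_trans tl; rewrite subr_ge0 ltW.
have iJ : leb1.-integrable `[t1 - d, t1] (EFin \o (fun t => derive1 chi t * pairing psi t1)).
  by apply: (@integrable_mul_bounded _ _ _ _ _ _ _ `|pairing psi t1|).
have EJ : pairing psi t1 = - I +
    \int[leb1]_(t in `[t1 - d, t1]) (derive1 chi t * pairing psi t - derive1 chi t * pairing psi t1).
  by rewrite RintegralB// RintegralZr// chi1 mulN1r opprK addKr.
rewrite EJ (le_trans (ler_normD _ _))// normrN lerD//.
  apply: (le_trans bI).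
  rewrite [leLHS](_ : _ = \int[leb1]_(t in `[0, t1]) (M * A * C * (b - a) * expR (lam * t))).
    apply: (le_trans (Rintegral_expR_le _ lam0 t10)).
      by rewrite !mulr_ge0// subr_ge0.
    rewrite le_eqVlt; apply/orP; left; apply/eqP; field.
    by rewrite gt_eqF.
  by apply: eq_Rintegral => t _; ring.
have iD : leb1.-integrable `[t1 - d, t1]
    (EFin \o (fun t => derive1 chi t * pairing psi t - derive1 chi t * pairing psi t1)).
  exact: (integrableB _ ichi iJ).
apply: (le_trans (le_normr_Rintegral _ iD)) => //.
apply: (@le_trans _ _ (\int[leb1]_(t in `[t1 - d, t1]) (derive1 chi t * - e))).
  apply: le_Rintegral => //; first exact: integrable_norm.
    by apply: (@integrable_mul_bounded _ _ _ _ _ _ _ `|- e|).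
  move=> t tI; rewrite -mulrBr normrM (ler0_norm (chi'0 t tI)) mulrN -mulNr ler_wpM2l ?oppr_ge0 ?chi'0//.
  move: tI; rewrite /= in_itv/= => /andP[tl tr].
  apply: hd'; first lra.
  by rewrite ler0_norm; lra.
by rewrite RintegralZr// chi1 mulN1r opprK.
Qed.

End time_slice.

(** * Functions with vanishing pairings *)

Section vanishing.
Context {R : realType}.
Variables (eta : R -> R).
Hypothesis eta_kernel : convolution_kernel eta.
Hypothesis eta_ge0 : forall x : R, 0 <= x -> eta x = 0.

(** Plateaus supported in [[0, x]] converge to 1 at every point of []0, x[], so by dominated
    convergence [f] has zero integral over [[0, x]]. Lebesgue differentiation in [x] then recovers
    [f]. *)
Lemma ae_eq0_pairing (f : R -> R) : leb1.-integrable setT (EFin \o f) ->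
  (forall psi : R -> R, smooth psi -> forall a b : R, 0 <= a -> a <= b -> supported a b psi ->
    \int[leb1]_x (f x * psi x) = 0) ->
  {ae leb1, forall x : R, 0 < x -> f x = 0}.
Proof.
move=> fi f0.
have mf : measurable_fun setT f by apply/measurable_EFinP; exact: measurable_int fi.
have F0 (x : R) : 0 < x -> \int[leb1]_(y in `[0, x]) f y = 0.
  move=> x0; pose r n : R := x / n.+2%:R.
  have r0 n : 0 < r n by rewrite divr_gt0.
  have rx n : r n <= x by rewrite ler_pdivrMr// ler_peMr ?ler1n//; exact: ltW.
  pose psi n := plateau eta (r n) x (r n).
  have spsi n : smooth (psi n) by exact: smooth_plateau.
  have suppsi n : supported 0 x (psi n).
    by rewrite -{1}(subrr (r n)); exact: supported_plateau.
  have mpsi n : measurable_fun setT (psi n).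
    exact: (continuous_measurable (smooth_continuous (spsi n))).
  have psi1 n y : `|psi n y| <= 1.
    by rewrite ger0_norm; [exact: plateau_le1|exact: plateau_ge0].
  have mE (g : R -> R) (D : set R) : measurable_fun setT g -> measurable_fun D (EFin \o g).
    by move=> mg; apply: measurable_funTS; exact/measurable_EFinP.
  have ifD : leb1.-integrable `]0, x[ (EFin \o (fun y => `|f y|)).
    by apply: integrable_norm; exact: integrableS fi.
  have cvf : {ae leb1, forall y : R, `]0, x[%classic y ->
      (f y * psi n y)%:E @[n --> \oo] --> (f y)%:E}.
    apply: aeW => y; rewrite /= in_itv/= => /andP[y0 yx].
    apply: cvg_EFin; first exact: nearW.
    apply: (@cvg_trans _ (f y @[_ --> \oo])); last exact: cvg_cst.
    apply: near_eq_cvg; near=> n => /=.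
    (* Once [n] exceeds [x / min (y, x - y)], the point [y] lies on the flat part of [psi n]. *)
    have rny : r n <= Num.min y (x - y).
      rewrite ler_pdivrMr// mulrC -ler_pdivrMr ?lt_min ?subr_gt0 ?y0//.
      apply: (@le_trans _ _ n%:R); last by rewrite ler_nat ltnW.
      by near: n; exact: nbhs_infty_ger.
    move: rny; rewrite le_min => /andP[ry rxy].
    by rewrite /psi plateau_one ?mulr1//; lra.
  have dom : {ae leb1, forall (y : R) n, `]0, x[%classic y ->
      (`|(f y * psi n y)%:E| <= (`|f y|)%:E)%E}.
    by apply: aeW => y n _ /=; rewrite lee_fin normrM -[leRHS]mulr1 ler_pM.
  have [_ _] := @dominated_convergence _ _ R lebesgue_measure `]0, x[ (measurable_itv _)
    (fun n => EFin \o (fun y => f y * psi n y)) (EFin \o f) (EFin \o (fun y => `|f y|))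
    (fun n => mE _ _ (measurable_funM mf (mpsi n))) (mE _ _ mf) cvf ifD dom.
  rewrite (_ : [sequence _]_n = cst 0%E); last first.
    apply/funext => n /=.
    have <- : (\int[leb1]_y (f y * psi n y)%:E = 0)%E.
      rewrite -[LHS]fineK.
        by congr EFin; exact: f0 (spsi n) 0 x (lexx 0) (ltW x0) (suppsi n).
      apply: integrable_fin_num => //.
      by apply: (@integrable_mul_bounded _ _ _ _ _ _ _ 1) => //; exact: mpsi.
    rewrite integral_mkcond; apply: eq_integral => y _; rewrite patchE.
    have [//|] := boolP (y \in `]0, x[%classic).
    rewrite notin_setE/= in_itv/= => /negP; rewrite negb_and -!leNgt => /suppsi->.
    by rewrite mulr0.
  move=> cvg0; rewrite /Rintegral integral_itv_bndoo; last exact: mE.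
  suff -> : (\int[leb1]_(y in `]0%R, x[) (EFin \o f) y = 0)%E by [].
  by rewrite -(cvg_lim (@ereal_hausdorff R) cvg0) lim_cst//; exact: ereal_hausdorff.
have lf : locally_integrable [set: R] f.
  by apply: open_integrable_locally => //; exact: openT.
have iy (y : R) : leb1.-integrable [set` Interval (BLeft 0) (BRight y)] (EFin \o f).
  exact: integrableS fi.
have := @FTC1 R f (BLeft 0) iy lf.
apply: ae_imply => x fx x0; have [|_ <-] := fx; first exact: x0.
rewrite derive1E (@near_eq_derive _ _ _ _ (cst 0)) ?derive_cst//.
have := @near_in_itvoy R 0 x; rewrite in_itv/= andbT => /(_ x0).
by apply: filterS => y; rewrite in_itv/= andbT => y0; exact: F0.
Unshelve. all: by end_near. Qed.

End vanishing.

(** * No mass on the right half-line *)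

Section support.
Context {R : realType}.
Variables (eta : R -> R) (k : R -> R) (v : R * R -> R).
Hypothesis eta_kernel : convolution_kernel eta.
Hypothesis eta_ge0 : forall x : R, 0 <= x -> eta x = 0.
Hypothesis sk : smooth k.
Hypothesis k_supp : supported (-1) 0 k.
Hypothesis v_space : solution_space v.
Hypothesis v_sol : distributional_solution +oo (@ubar R) v (fun z => v z * conv_x v k z).

Let ck : continuous k := smooth_continuous sk.

(** This is [k (x - z)] as a function of [z]. Since [k] lives on [[-1, 0]], its support lies in
    [[x, x + 1]], so [pairing_le] applies to the velocity itself when [x >= 0]. *)
Definition shifted (x : R) : R -> R := fun z => 1 * k (-1 * z + x).

Lemma smooth_shifted x : smooth (shifted x).
Proof. exact: smooth_affine. Qed.

Lemma supported_shifted x : supported x (x + 1) (shifted x).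
Proof.
move=> z zx; rewrite /shifted mul1r k_supp//.
by case/orP: zx => zx; apply/orP; [right|left]; lra.
Qed.

Lemma measurable_slice (t : R) : 0 <= t -> measurable_fun setT (fun x => v (t, x)).
Proof.
by have [_ _ vi _] := v_space => /vi; move/(measurable_int _)/measurable_EFinP.
Qed.

Lemma conv_x_pairing (t x : R) : 0 <= t -> conv_x v k (t, x) = pairing v (shifted x) t.
Proof.
move=> t0; rewrite conv_xE//; last exact: measurable_slice.
by apply: eq_Rintegral => z _; rewrite /shifted mul1r mulN1r addrC.
Qed.

(** Time 0 is set aside because the cutoff needs room, [0 < d < t1]. *)
Lemma ae_neq0 : {ae leb1, forall t : R, t != 0}.
Proof.
exists [set 0]; split => //; first exact: lebesgue_measure_set1.
by move=> t /= /negP; rewrite negbK => /eqP.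
Qed.

Lemma le_geometric_eq0 (x B : R) : 0 <= x -> (forall n, x <= B / 2 ^+ n) -> x = 0.
Proof.
move=> x0 xB; apply/eqP; rewrite eq_le x0 andbT leNgt; apply/negP => xpos.
have [n nB] : exists n : nat, B / x < n%:R.
  exists (Num.truncn `|B / x|).+1; rewrite (le_lt_trans (ler_norm _))//.
  exact: truncnS_gt.
have := xB n; rewrite ler_pdivlMr ?exprn_gt0// leNgt => /negP; apply.
rewrite mulrC -ltr_pdivrMr// (lt_trans nB)// -natrX ltr_nat.
exact: ltn_expl.
Qed.

Section pairings.
Variables (T0 M : R).
Hypothesis M0 : 0 < M.
Hypothesis vM : {ae leb1, forall t : R, 0 <= t <= T0 ->
  {ae leb1, forall x : R, `|v (t, x)| <= M}}.

(* Each round bounds the velocity on [x >= 0] by a time integral of the previous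
   bound; the exponential weight makes this a contraction by 1/2. *)
Let conv_decay : exists A lam : R, [/\ 0 <= A, 0 < lam & forall n,
  {ae leb1, forall t : R, 0 <= t <= T0 -> forall x : R, 0 <= x ->
    `|conv_x v k (t, x)| <= A / 2 ^+ n * expR (lam * t)}].
Proof.
have [Ck Ck0 hCk] := supported_bounded k_supp ck.
have ck' := smooth_continuous (smooth_derive sk).
have [C C0 hC] := supported_bounded (supported_derive k_supp sk) ck'.
(* The interval carrying [shifted x] has length 1, so a round multiplies the bound by [M * C / lam];
   this [lam] makes the factor 1/2. The starting bound [M * Ck] is the product of the bounds on
   solution and kernel. *)
have lam0 : 0 < 2 * M * C by rewrite !mulr_gt0.
exists (M * Ck), (2 * M * C); split=> [||n]; [by rewrite mulr_ge0// ltW|by []|].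
have A0 m : 0 <= M * Ck / 2 ^+ m by rewrite divr_ge0 ?exprn_ge0// mulr_ge0// ltW.
elim: n => [|n IH].
  apply: ae_imply vM => t hM /[dup] /andP[t0 _] /hM {}hM x x0.
  have hs y : `|shifted x y| <= Ck by rewrite /shifted mul1r.
  rewrite expr0 divr1 conv_x_pairing// (@le_trans _ _ (M * Ck))//; last first.
    apply: ler_peMr; first by rewrite mulr_ge0// ltW.
    by rewrite -[leLHS]expR0 ler_expR mulr_ge0// ltW.
  have xx : x <= x + 1 by rewrite lerDl.
  have ms := continuous_measurable (smooth_continuous (@smooth_shifted x)).
  have sout y : y \notin `[x, x + 1] -> shifted x y = 0.
    rewrite in_itv/= negb_and -!ltNge => /orP[] /ltW yx; apply: supported_shifted.
      by rewrite yx.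
    by rewrite yx orbT.
  have := integral_bounded_mul_le (measurable_slice t0) ms hM sout hs xx.
  rewrite addrAC subrr add0r mulr1 => le.
  have ifs : leb1.-integrable setT (EFin \o (fun y => v (t, y) * shifted x y)).
    apply/integrableP; split; last exact: le_lt_trans le (ltry _).
    by apply/measurable_EFinP/measurable_funM => //; exact: measurable_slice.
  rewrite -lee_fin; apply: le_trans le.
  rewrite /pairing /Rintegral -abse_EFin fineK; last exact: integrable_fin_num.
  by apply: le_abse_integral => //; exact: (measurable_int _ ifs).
apply: ae_imply ae_neq0 => t tneq0 /andP[t0 tT] x x0.
rewrite conv_x_pairing//.
have hC' y : `|derive1 (shifted x) y| <= C.
  by rewrite derive1_affine// mul1r mulN1r normrN.
have t0T : 0 < t <= T0 by rewrite lt_neqAle eq_sym tneq0 t0.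
have xx : x <= x + 1 by rewrite lerDl.
have := pairing_le eta_kernel eta_ge0 ck v_space v_sol (@smooth_shifted x)
  (@supported_shifted x) x0 xx (ltW M0) (A0 n) lam0 vM hC' IH t0T.
rewrite (_ : M * C * _ * _ / _ = M * Ck / 2 ^+ n.+1)//.
rewrite exprS; field.
by rewrite expf_neq0//= !gt_eqF.
Qed.

(** The decaying velocity bounds are fed once more into [pairing_le], now with an arbitrary [psi];
    the number of rounds [n] is free, so the pairing is below every [B / 2 ^+ n]. *)
Lemma pairing_eq0 (psi : R -> R) (a b t : R) : smooth psi -> supported a b psi ->
  0 <= a -> a <= b -> 0 < t <= T0 -> pairing v psi t = 0.
Proof.
move=> spsi psi_supp a0 ab tT; have [A [lam [A0 lam0 dec]]] := conv_decay.
have cpsi' := smooth_continuous (smooth_derive spsi).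
have [C C0 hC] := supported_bounded (supported_derive psi_supp spsi) cpsi'.
apply/normr0_eq0; apply: (@le_geometric_eq0 _ (M * C * (b - a) * A / lam * expR (lam * t))) => // n.
have An : 0 <= A / 2 ^+ n by rewrite divr_ge0 ?exprn_ge0.
have := pairing_le eta_kernel eta_ge0 ck v_space v_sol spsi psi_supp a0 ab (ltW M0) An lam0 vM hC (dec n) tT.
rewrite (_ : M * C * (b - a) * (A / 2 ^+ n) / lam * _ = M * C * (b - a) * A / lam * expR (lam * t) / 2 ^+ n)//.
by field; rewrite expf_neq0//= gt_eqF.
Qed.

Lemma slice_eq0 (t : R) : 0 < t <= T0 -> {ae leb1, forall x : R, 0 < x -> v (t, x) = 0}.
Proof.
move=> tT; apply: (ae_eq0_pairing eta_kernel eta_ge0).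
  by have [_ _ vi _] := v_space; apply: vi; case/andP: tT => /ltW.
by move=> psi spsi a b a0 ab psi_supp; exact: (pairing_eq0 spsi psi_supp a0 ab tT).
Qed.

End pairings.

(** For each [t] in []0, T]] the product vanishes for almost every [x]: by [g] on the left, by [v]
    on the right. Hence [tonelli_bound] applies with majorant 0. *)
Lemma integral_right_eq0 (T : R) (g : R * R -> R) : measurable_fun (slab T%:E) g ->
  (forall t x : R, x <= 0 -> g (t, x) = 0) -> 0 <= T ->
  \int[leb2]_(z in slab T%:E) (v z * g z) = 0.
Proof.
move=> mg g0 T0; have [mv vb _ _] := v_space; have [M vM] := vb T.
have {}vM : {ae leb1, forall t : R, 0 <= t <= T -> {ae leb1, forall x : R, `|v (t, x)| <= `|M| + 1}}.
  apply: ae_imply vM => t + tT => /(_ tT); apply: ae_imply => x /le_trans; apply.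
  by rewrite (le_trans (ler_norm _))// lerDl.
have M0 : 0 < `|M| + 1 by rewrite ltr_wpDl.
have mS : measurable (slab T%:E : set (R * R)) by apply: measurable_slab; rewrite lee_fin.
have mG : measurable_fun setT ((fun z => v z * g z) \_ (slab T%:E)).
  apply/(measurable_restrictT _ _).1 => //; apply: measurable_funM => //.
  apply: measurable_funS mv; first exact: measurable_slab.
  by move=> [t x] [/= t0 _]; split=> //; rewrite leey.
rewrite Rintegral_mkcond; apply/normr0_eq0/le_anti; rewrite normr_ge0 andbT.
have [||||_] := @tonelli_bound R ((fun z => v z * g z) \_ (slab T%:E)) (cst 0) T mG.
- move=> t x; rewrite in_itv/= => tT; rewrite patchE memNset//.
  by rewrite slabE => -[/= + _]; rewrite in_itv/= => tT'; rewrite tT' in tT.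
- by apply: integrable0.
- by [].
- apply: ae_imply ae_neq0 => t tneq0 /andP[t0 tT].
  have t0T : 0 < t <= T by rewrite lt_neqAle eq_sym tneq0 t0.
  have := slice_eq0 M0 vM t0T => v0.
  rewrite (_ : (\int[leb1]_x _ = 0)%E)//; apply/eqP; rewrite eq_le.
  apply/andP; split; last exact: integral_ge0.
  rewrite -[leRHS](@integral0 _ _ _ leb1 setT).
  apply: ae_ge0_le_integral => //.
    apply: measurableT_comp => //; apply/measurable_EFinP.
    exact: (measurable_fun_pair2 t mG).
  apply: ae_imply v0 => x vx _; rewrite patchE; case: ifPn => _; last by rewrite abse0.
  by have [/g0->|/vx->] := leP x 0; rewrite ?mulr0 ?mul0r abse0.
by rewrite Rintegral_cst// mul0r.
Qed.

End support.

(** * Profiles for the Burgers equation *)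

Section burgers.
Context {R : realType}.
Variables (eta : R -> R).
Hypothesis eta_kernel : convolution_kernel eta.
Hypothesis eta_ge0 : forall x : R, 0 <= x -> eta x = 0.

Implicit Types (a b d x y mu : R).

(** Flat on [[-1, 0]] and nondecreasing left of 0; its descent takes place on [[0, 1]], where the
    Burgers solution will vanish. *)
Let bump : R -> R := plateau eta (-1) 1 1.
Let Bump : R -> R := primitive bump.

Let sbump : smooth bump. Proof. exact: smooth_plateau. Qed.

Let bump_supp : supported (-2) 1 bump.
Proof.
rewrite (_ : -2 = -1 - 1 :> R); last by lra.
by apply: supported_plateau => //; lra.
Qed.

Let bump_ge0 x : 0 <= bump x. Proof. by apply: plateau_ge0 => //; lra. Qed.

Let sBump : smooth Bump. Proof. exact: (smooth_primitive_int bump_supp sbump). Qed.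

Let cbump : continuous bump := smooth_continuous sbump.

Definition low_profile (d : R) : R -> R := fun x => 1 * bump (d^-1 * x + 0).

(** The ramp [Bump] never returns to 0. Subtracting its translate by 3, the length of [[-2, 1]],
    restores compact support and alters nothing for [y <= 1], hence not the derivative on
    [y <= 0]. *)
Let bump2 : R -> R := fun y => 1 * Bump (1 * y + 0) - 1 * Bump (1 * y + (-3)).

Definition high_profile (d : R) : R -> R := fun x => 1 * bump2 (d^-1 * x + 0).

Lemma smooth_low_profile d : smooth (low_profile d).
Proof. exact: smooth_affine. Qed.

Let sbump2 : smooth bump2.
Proof. by apply: smoothB; exact: (smooth_affine _ _ _ sBump). Qed.

Lemma smooth_high_profile d : smooth (high_profile d).
Proof. exact: smooth_affine. Qed.

Let bump2_supp : supported (-2) 4 bump2.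
Proof.
move=> y; rewrite /bump2 !mul1r addr0 => /orP[y2|y4].
  rewrite /Bump !(primitive_le bump_supp) ?subrr//.
  by apply: le_trans y2; rewrite lerBlDr lerDl.
by rewrite /Bump !(primitive_ge bump_supp) ?subrr//; lra.
Qed.

Let bump2_ge0 y : 0 <= bump2 y.
Proof.
rewrite /bump2 !mul1r addr0 subr_ge0.
by apply: (primitive_ndecr bump_supp) => //; rewrite lerBlDr lerDl.
Qed.

Let bump2_le y : bump2 y <= \int[leb1]_x bump x.
Proof.
rewrite /bump2 !mul1r addr0 lerBlDr.
have := primitive_le_int y bump_supp cbump bump_ge0.
by move/le_trans; apply; rewrite lerDl; exact: primitive_ge0.
Qed.

Let derive1_bump2 y : y <= 0 -> derive1 bump2 y = bump y.
Proof.
move=> y0; have dB (a b : R) : derivable (fun y : R => 1 * Bump (a * y + b)) y 1.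
  exact: (@smooth_derivable _ _ y (smooth_affine a b 1 sBump)).
rewrite derive1E deriveB// -!derive1E !(derive1_affine _ _ _ _ sBump).
rewrite (derive1_primitive bump_supp cbump) !mul1r addr0 (bump_supp (x := y - 3)) ?subr0//.
by apply/orP; left; lra.
Qed.

Section scaled.
Variable d : R.
Hypothesis d0 : 0 < d.

Let scaled_supp (f : R -> R) b : supported (-2) b f ->
  supported (-2 * d) (b * d) (fun x => 1 * f (d^-1 * x + 0)).
Proof.
move=> sf x /orP[xl|xr]; rewrite mul1r addr0 mulrC sf//; apply/orP; [left|right].
- by rewrite ler_pdivrMr.
- by rewrite ler_pdivlMr.
Qed.

(** The right end is rounded up to 4, which serves both profiles and every [d <= 1]; this is the
    origin of the range [0 < x <= 4] on which limits are shown to vanish. *)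
Lemma supported_low_profile : d <= 1 -> supported (-2 * d) 4 (low_profile d).
Proof.
move=> d1 x xb; apply: (scaled_supp bump_supp); case/orP: xb => [->//|x4].
by apply/orP; right; rewrite mul1r (le_trans d1)// (le_trans _ x4)// ler1n.
Qed.

Lemma supported_high_profile : d <= 1 -> supported (-2 * d) 4 (high_profile d).
Proof.
move=> d1 x xb; apply: (scaled_supp bump2_supp); case/orP: xb => [->//|x4].
by apply/orP; right; rewrite (le_trans _ x4)// ler_piMr.
Qed.

Lemma low_profile_ge0 x : 0 <= low_profile d x.
Proof. by rewrite /low_profile mul1r. Qed.

Lemma low_profile_le1 x : low_profile d x <= 1.
Proof. by rewrite /low_profile mul1r; exact: plateau_le1. Qed.

Lemma low_profile1 x : - d <= x -> x <= 0 -> low_profile d x = 1.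
Proof.
move=> dx x0; rewrite /low_profile mul1r addr0 mulrC; apply: plateau_one => //.
  by rewrite ler_pdivlMr// mulN1r.
by rewrite subrr ler_pdivrMr// mul0r.
Qed.

Lemma derive1_low_profile_ge0 x : x <= 0 -> 0 <= derive1 (low_profile d) x.
Proof.
move=> x0; rewrite derive1_affine// mul1r; apply: mulr_ge0.
  by rewrite invr_ge0 ltW.
apply: derive1_plateau_ge0 => //.
by rewrite subrr addr0 mulrC ler_pdivrMr// mul0r.
Qed.

Lemma high_profile_ge0 x : 0 <= high_profile d x.
Proof. by rewrite /high_profile mul1r. Qed.

Lemma high_profile_le x : high_profile d x <= \int[leb1]_y bump y.
Proof. by rewrite /high_profile mul1r. Qed.

Lemma derive1_high_profile x : x <= 0 -> derive1 (high_profile d) x = d^-1 * low_profile d x.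
Proof.
move=> x0; rewrite derive1_affine// mul1r derive1_bump2 /low_profile ?mul1r//.
by rewrite addr0 mulrC ler_pdivrMr// mul0r.
Qed.

End scaled.

Lemma normr_le_sqr (x mu : R) : 0 < mu -> `|x| <= x ^+ 2 / (4 * mu) + mu.
Proof.
move=> mu0; rewrite -subr_ge0.
rewrite (_ : _ - _ = (`|x| - 2 * mu) ^+ 2 / (4 * mu)).
  by rewrite divr_ge0 ?sqr_ge0// mulr_ge0// ltW.
by rewrite -[x ^+ 2]real_normK ?num_real//; field; rewrite gt_eqF.
Qed.

(** From [|a| <= a ^+ 2 / (4 * mu) + mu]. The weight [s] is kept on the square, where it will
    rebuild the weighted integral of [w ^+ 2], and bounded by 1 in the remainder. *)
Lemma young_flux (a r s C mu : R) : 0 < mu -> 0 <= C -> 0 <= s <= 1 -> `|r| <= C * s ->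
  - (a ^+ 2 * s * (C / (4 * mu)) + C * mu) <= a * r.
Proof.
move=> mu0 C0 /andP[s0 s1] rCs; rewrite lerNl; apply: le_trans (ler_norm _) _.
rewrite normrN normrM (@le_trans _ _ (`|a| * (C * s)))// ?ler_wpM2l//.
apply: (@le_trans _ _ ((a ^+ 2 / (4 * mu) + mu) * (C * s))).
  by rewrite ler_wpM2r ?mulr_ge0// normr_le_sqr.
rewrite mulrDl; apply: lerD.
  by rewrite le_eqVlt; apply/orP; left; apply/eqP; field; rewrite gt_eqF.
rewrite mulrC ler_wpM2r//; first exact: ltW.
by rewrite -[leRHS]mulr1 ler_wpM2l.
Qed.

End burgers.

(** * Burgers solutions supported in [x <= 0] *)

Section no_outflow.
Context {R : realType}.
Variables (eta : R -> R) (T : R) (w : R * R -> R).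
Hypothesis eta_kernel : convolution_kernel eta.
Hypothesis eta_ge0 : forall x : R, 0 <= x -> eta x = 0.
Hypothesis T0 : 0 < T.
Hypothesis mw : measurable_fun (slab T%:E) w.
Hypothesis w2 : leb2.-integrable (`[0, T] `*` `[-2, 0]) (fun z : R * R => (w z ^+ 2)%:E).
Hypothesis w_right : {ae leb2, forall z : R * R, 0 <= z.1 <= T -> 0 < z.2 <= 4 -> w z = 0}.
(** The weak formulation is stated for nonnegative products only, the form that entropy inequalities
    can also deliver. *)
Hypothesis w_sol : forall (chi psi : R -> R) (a b c d : R), smooth chi -> smooth psi ->
  supported a b chi -> b < T -> supported c d psi ->
  (forall t, 0 <= chi t) -> (forall x, 0 <= psi x) ->
  \int[leb2]_(z in slab T%:E) (w z * dt (tensor chi psi) z + w z ^+ 2 * dx (tensor chi psi) z)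
    + \int[leb1]_x (tensor chi psi (0, x) * ubar x) = 0.

Implicit Types (d c mu : R) (chi psi : R -> R).

Let K (d : R) : set (R * R) := `[0, T] `*` `[-2 * d, 0].

Let mK d : measurable (K d).
Proof. by apply: measurableX. Qed.

Let mS : measurable (slab T%:E : set (R * R)).
Proof. by apply: measurable_slab; rewrite lee_fin ltW. Qed.

Let K_slab d : K d `<=` slab T%:E.
Proof. by rewrite slabE => z [? _]; split. Qed.

Let leb2K d : 0 < d -> leb2 (K d) = (T * (2 * d))%:E.
Proof.
move=> d0; rewrite product_measure1E//= !lebesgue_measure_itv/= !lte_fin T0.
by rewrite mulNr oppr_lt0 mulr_gt0// -!EFinB -EFinM subr0 sub0r opprK.
Qed.

Let F (chi psi : R -> R) (z : R * R) :=
  w z * tensor (derive1 chi) psi z + w z ^+ 2 * tensor chi (derive1 psi) z.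

Let mF chi psi : smooth chi -> smooth psi -> measurable_fun (slab T%:E) (F chi psi).
Proof.
move=> schi spsi; apply: measurable_funD; apply: measurable_funM => //.
- apply: measurable_funTS; apply: measurable_tensor; apply: smooth_continuous => //.
  exact: smooth_derive.
- exact: measurable_funX.
- apply: measurable_funTS; apply: measurable_tensor; apply: smooth_continuous => //.
  exact: smooth_derive.
Qed.

(** Left of [-2 * d] and right of 4 the profile vanishes, and between 0 and 4 almost everywhere [w]
    does. What remains is a strip whose measure is proportional to [d]. *)
Let slab_K chi psi d : smooth chi -> smooth psi -> supported (-2 * d) 4 psi ->
  \int[leb2]_(z in slab T%:E) F chi psi z = \int[leb2]_(z in K d) F chi psi z.
Proof.
move=> schi spsi psi_supp; have spsi' := supported_derive psi_supp spsi.
rewrite Rintegral_mkcond [RHS]Rintegral_mkcond /Rintegral; congr fine.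
apply: ae_eq_integral => //.
- apply/measurable_EFinP; exact: ((measurable_restrictT (F chi psi) mS).1 (mF schi spsi)).
- apply/measurable_EFinP; apply: (measurable_restrictT (F chi psi) (@mK d)).1.
  by apply: measurable_funS (mF schi spsi) => //; exact: K_slab.
apply: (@filterS _ _ (ae_filter_ringOfSetsType (lebesgue_measure \x lebesgue_measure)%E) _ _ _ w_right).
move=> [t x] /= w0 _; congr EFin; rewrite !patchE.
have [zS|zS] := boolP ((t, x) \in slab T%:E); last first.
  rewrite memNset// => /K_slab zS'; by move: zS; rewrite notin_setE.
case: ifPn => // zK; rewrite /F /tensor/=.
have [tT xK] : 0 <= t <= T /\ (x < -2 * d) || (0 < x).
  move: zS zK; rewrite inE notin_setE slabE /K/= !in_itv/= => -[tT _] zK; split=> //.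
  apply: contra_notT zK; rewrite negb_or -!leNgt => ?; by split.
have [x4|x4] := leP 4 x; first by rewrite psi_supp ?spsi' ?x4 ?orbT// !mulr0 addr0.
case/orP: xK => [x2|x0]; first by rewrite psi_supp ?spsi' ?(ltW x2)// !mulr0 addr0.
have wz : w (t, x) = 0 by apply: w0 => //; rewrite x0 ltW.
by rewrite wz expr2 !mul0r addr0.
Qed.

Let iw2 d : 0 < d -> d <= 1 -> leb2.-integrable (K d) (EFin \o (fun z => w z ^+ 2)).
Proof.
move=> d0 d1; apply: integrableS w2; [exact: measurableX|exact: mK|].
move=> [t x] [tT /=]; rewrite !in_itv/= => /andP[x2 x0]; split=> //=.
by rewrite x0 andbT (le_trans _ x2)// ler_nMr.
Qed.

Let icst d (c : R) : 0 < d -> leb2.-integrable (K d) (EFin \o (fun=> c)).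
Proof.
move=> d0; have leK : (leb2 (K d) < +oo)%E by rewrite leb2K// ltry.
apply: measurable_bounded_integrable; [exact: mK|exact: leK|exact: measurable_cst|].
by exists `|c|; split; [exact: num_real|move=> y cy z _ /=; exact: ltW].
Qed.

Let iwn d : 0 < d -> d <= 1 -> leb2.-integrable (K d) (EFin \o (fun z => `|w z|)).
Proof.
move=> d0 d1.
have mwK : measurable_fun (K d) w by apply: measurable_funS mw => //; exact: K_slab.
have ig : leb2.-integrable (K d) (EFin \o (fun z => w z ^+ 2 + 1)).
  by apply: integrable_add_EFin; [exact: mK|exact: iw2|exact: icst].
apply: integrable_dominated ig.
- exact: mK.
- exact: measurableT_comp.
- move=> z _; rewrite normr_id.
  have := @normr_le_sqr _ (w z) 1 ltr01; rewrite mulr1 => /le_trans; apply.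
  by rewrite lerD2r ler_pdivrMr// ler_peMr ?sqr_ge0// ler1n.
Qed.

Let iw d : 0 < d -> d <= 1 -> leb2.-integrable (K d) (EFin \o w).
Proof.
move=> d0 d1; apply: integrable_dominated (iwn d0 d1); [exact: mK| |by []].
by apply: measurable_funS mw => //; exact: K_slab.
Qed.

Let iF chi psi a b d : smooth chi -> smooth psi -> supported a b chi ->
  supported (-2 * d) 4 psi -> 0 < d -> d <= 1 ->
  leb2.-integrable (K d) (EFin \o F chi psi).
Proof.
move=> schi spsi chi_supp psi_supp d0 d1.
have bounded (f g : R -> R) a1 b1 a2 b2 : continuous f -> continuous g ->
    supported a1 b1 f -> supported a2 b2 g ->
    exists C : R, forall z, `|tensor f g z| <= C.
  move=> cf cg fs gs; have [Cf _ hf] := supported_bounded fs cf.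
  have [Cg _ hg] := supported_bounded gs cg.
  by exists (Cf * Cg) => z; rewrite /tensor normrM ler_pM.
have cchi := smooth_continuous schi; have cpsi := smooth_continuous spsi.
have cchi' := smooth_continuous (smooth_derive schi).
have cpsi' := smooth_continuous (smooth_derive spsi).
have [C1 h1] := bounded _ _ _ _ _ _ cchi' cpsi (supported_derive chi_supp schi) psi_supp.
have [C2 h2] := bounded _ _ _ _ _ _ cchi cpsi' chi_supp (supported_derive psi_supp spsi).
apply: integrable_add_EFin; first exact: mK.
- apply: (@integrable_mul_bounded _ _ _ _ _ _ _ C1) => //; [exact: mK|exact: iw|].
  by apply: measurable_funTS; exact: measurable_tensor.
- apply: (@integrable_mul_bounded _ _ _ _ _ _ _ C2) => //; [exact: mK|exact: iw2|].
  by apply: measurable_funTS; exact: measurable_tensor.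
Qed.

Let flux_le chi psi a b d (G : R * R -> R) : smooth chi -> smooth psi -> supported a b chi ->
  supported (-2 * d) 4 psi -> 0 < d -> d <= 1 -> b < T ->
  (forall t, 0 <= chi t) -> (forall x, 0 <= psi x) ->
  leb2.-integrable (K d) (EFin \o G) -> (forall z, K d z -> G z <= F chi psi z) ->
  \int[leb2]_(z in K d) G z + \int[leb1]_x (tensor chi psi (0, x) * ubar x) <= 0.
Proof.
move=> schi spsi chi_supp psi_supp d0 d1 bT chi0 psi0 iG GF.
rewrite -[leRHS](w_sol schi spsi chi_supp bT psi_supp chi0 psi0) lerD2r.
rewrite (dt_tensor psi schi) (dx_tensor chi spsi).
rewrite [leRHS](slab_K schi spsi psi_supp).
apply: le_Rintegral => //; first exact: mK.
exact: (iF schi spsi chi_supp psi_supp d0 d1).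
Qed.

Let Rintegral_affine d (f g : R * R -> R) (a b c : R) : 0 < d ->
  leb2.-integrable (K d) (EFin \o f) -> leb2.-integrable (K d) (EFin \o g) ->
  leb2.-integrable (K d) (EFin \o (fun z => f z * a + g z * b + c)) /\
  \int[leb2]_(z in K d) (f z * a + g z * b + c) =
    (\int[leb2]_(z in K d) f z) * a + (\int[leb2]_(z in K d) g z) * b + c * (T * (2 * d)).
Proof.
move=> d0 fi gi.
have scale (h : R * R -> R) (e : R) : leb2.-integrable (K d) (EFin \o h) ->
    leb2.-integrable (K d) (EFin \o (fun z => h z * e)).
  by move=> hi; apply: (@integrable_mul_bounded _ _ _ _ _ _ _ `|e|) => //; exact: mK.
have fai := scale f a fi; have gbi := scale g b gi.
have fgi : leb2.-integrable (K d) (EFin \o (fun z => f z * a + g z * b)).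
  by apply: integrable_add_EFin => //; exact: mK.
have ci := icst c d0.
split; first by apply: integrable_add_EFin => //; exact: mK.
rewrite RintegralD//; last exact: mK.
rewrite RintegralD//; last exact: mK.
rewrite RintegralZr//; last exact: mK.
rewrite RintegralZr//; last exact: mK.
congr (_ + _); rewrite Rintegral_cst//; last exact: mK.
by congr (_ * _); have := leb2K d0 => /= ->.
Qed.

(** The cutoffs are nested: [chi1] vanishes from [T / 2] on, and [chi2] equals 1 on [[0, T / 2]], so
    [chi2] dominates the derivative of [chi1] for [t >= 0]; [chi2] itself ends at
    [3 * T / 4 < T]. *)
Let chi1 := plateau eta 0 (T / 2) (T / 4).
Let chi2 := plateau eta 0 (3 * T / 4) (T / 4).

Let T4 : 0 < T / 4. Proof. by rewrite divr_gt0. Qed.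

Let T2 : 0 <= T / 2. Proof. by rewrite divr_ge0// ltW. Qed.

Let T34 : 0 <= 3 * T / 4. Proof. by rewrite divr_ge0// mulr_ge0// ltW. Qed.

Let schi1 : smooth chi1. Proof. exact: smooth_plateau. Qed.

Let schi2 : smooth chi2. Proof. exact: smooth_plateau. Qed.

Let chi1_supp : supported (0 - T / 4) (T / 2) chi1. Proof. exact: supported_plateau. Qed.

Let chi2_supp : supported (0 - T / 4) (3 * T / 4) chi2. Proof. exact: supported_plateau. Qed.

Let chi2_ge0 t : 0 <= chi2 t. Proof. exact: plateau_ge0. Qed.

Let chi1_ge0 t : 0 <= chi1 t. Proof. exact: plateau_ge0. Qed.

Let chi1_derive : exists2 C : R, 0 < C & forall t, 0 <= t -> `|derive1 chi1 t| <= C * chi2 t.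
Proof.
have cchi1' := smooth_continuous (smooth_derive schi1).
have [C C0 hC] := supported_bounded (supported_derive chi1_supp schi1) cchi1'.
exists C => // t t0; have [tT|tT] := leP t (T / 2).
  rewrite [chi2 t](_ : _ = 1) ?mulr1//; apply: plateau_one => //.
  by apply: (le_trans tT); lra.
by rewrite (supported_derive chi1_supp schi1) ?(ltW tT) ?orbT// normr0 mulr_ge0// ltW.
Qed.

Let low := low_profile eta.
Let high := high_profile eta.

(** The quantity on which the two estimates collide: [mass_le_flux] bounds it from below,
    [flux_small] from above. *)
Let Q d := \int[leb2]_(z in K d) (w z ^+ 2 * tensor chi2 (low d) z).

Let iQ d : 0 < d -> d <= 1 -> leb2.-integrable (K d) (EFin \o (fun z => w z ^+ 2 * tensor chi2 (low d) z)).
Proof.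
move=> d0 d1; apply: (@integrable_mul_bounded _ _ _ _ _ _ _ 1); [exact: mK|exact: iw2| |].
  apply: measurable_funTS; apply: (measurable_tensor (smooth_continuous schi2)).
  exact: smooth_continuous (smooth_low_profile eta_kernel eta_ge0 _).
move=> z _; rewrite /tensor ger0_norm; last by apply: mulr_ge0 => //; exact: low_profile_ge0.
by apply: mulr_ile1 => //; [exact: low_profile_ge0|exact: plateau_le1|exact: low_profile_le1].
Qed.

Let Ktriv d (t x : R) : K d (t, x) -> 0 <= t /\ x <= 0.
Proof. by rewrite /K/= !in_itv/= => -[/andP[-> _] /andP[_ ->]]. Qed.

Let initial_mass d : 0 < d -> d <= 1 ->
  d <= \int[leb1]_x (tensor chi1 (low d) (0, x) * ubar x).
Proof.
move=> d0 d1.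
have chi10 : chi1 0 = 1.
  by apply: plateau_one => //; have := T4; lra.
have slow := @smooth_low_profile _ _ eta_kernel eta_ge0 d.
have mlow := continuous_measurable (smooth_continuous slow).
have mprod : measurable_fun setT (fun x : R => tensor chi1 (low d) (0, x) * ubar x).
  apply: measurable_funM; last exact: measurable_indic.
  exact: (measurable_funM (measurable_cst (chi1 0)) mlow).
have i1 (a b : R) : leb1.-integrable setT (EFin \o (\1_(`]a, b[%classic : set R) : R -> R)).
  exact: integrable_indic_itv.
rewrite [leLHS](_ : d = \int[leb1]_x (\1_(`]- d, 0[%classic : set R) x)); last first.
  rewrite /Rintegral integral_indic// setIT /= lebesgue_measure_itv/= lte_fin oppr_lt0 d0.
  by rewrite -EFinB/= sub0r opprK.
apply: le_Rintegral; [exact: measurableT|exact: i1| |].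
  apply: integrable_dominated (i1 (-1) 0); [exact: measurableT|exact: mprod|].
  move=> x _; rewrite /tensor/= chi10 mul1r /ubar.
  rewrite ger0_norm; last by apply: mulr_ge0 => //; exact: low_profile_ge0.
  by rewrite ler_piMl//; exact: low_profile_le1.
move=> x _; rewrite /tensor/= chi10 mul1r /ubar !indicE.
have [xd|xd] := boolP (x \in _); last first.
  by apply: mulr_ge0 => //; exact: low_profile_ge0.
move: xd; rewrite inE/= in_itv/= => /andP[dx x0].
rewrite /low (low_profile1 eta_kernel eta_ge0 d0 (ltW dx) (ltW x0)) mul1r mem_set//= in_itv/= x0 andbT.
by apply: le_lt_trans dx; rewrite lerN2.
Qed.

Let mass_le_flux : exists2 C : R, 0 < C & forall d mu, 0 < d -> d <= 1 -> 0 < mu ->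
  d <= C / (4 * mu) * Q d + C * mu * (T * (2 * d)).
Proof.
have [C C0 hC] := chi1_derive; exists C => // d mu d0 d1 mu0.
have slow := @smooth_low_profile _ _ eta_kernel eta_ge0 d.
have low_supp := supported_low_profile eta_kernel eta_ge0 d0 d1.
have [iG EG] := Rintegral_affine (- (C / (4 * mu))) 0 (- (C * mu)) d0 (iQ d0 d1) (iQ d0 d1).
have TT : T / 2 < T by have := T0; lra.
have low0 := low_profile_ge0 eta_kernel eta_ge0 d.
have pointwise z : K d z ->
    w z ^+ 2 * tensor chi2 (low d) z * - (C / (4 * mu)) +
    w z ^+ 2 * tensor chi2 (low d) z * 0 + - (C * mu) <= F chi1 (low d) z.
  case: z => t x Ktx; have [t0 x0] := Ktriv Ktx.
  have p1 := low_profile_le1 eta_kernel eta_ge0 d x.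
  have dp0 := derive1_low_profile_ge0 eta_kernel eta_ge0 d0 x0.
  have c1 : chi2 t <= 1 by exact: plateau_le1.
  rewrite mulr0 addr0 mulrN -opprD /F /tensor/= -[leLHS]addr0; apply: lerD.
    apply: young_flux => //; first exact: ltW.
      by rewrite mulr_ge0//= mulr_ile1.
    by rewrite normrM [`|low d x|]ger0_norm// mulrA ler_wpM2r// hC.
  by rewrite mulr_ge0 ?sqr_ge0// mulr_ge0.
have := @flux_le chi1 (low d) _ _ d _ schi1 slow chi1_supp low_supp d0 d1 TT
  chi1_ge0 low0 iG pointwise.
rewrite EG mulr0 addr0 mulrN mulNr -opprD addrC subr_le0 => main.
by rewrite (le_trans (initial_mass d0 d1))// (le_trans main)// [Q d * _]mulrC.
Qed.

(** Test with [chi2] times [high d]. Its slope [low d / d] on [x <= 0] turns the flux term into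
    [Q d / d], the datum has the favourable sign, and Young bounds the time term. Enlarging [K d] to
    [K 1] gives an energy independent of [d]. *)
Let flux_small : exists2 C : R, 0 < C & forall d nu, 0 < d -> d <= 1 -> 0 < nu ->
  Q d <= d * (C / (4 * nu) * (\int[leb2]_(z in K 1) (w z ^+ 2)) + C * nu * (T * (2 * d))).
Proof.
have cchi2' := smooth_continuous (smooth_derive schi2).
have [D D0 hD] := supported_bounded (supported_derive chi2_supp schi2) cchi2'.
pose I := \int[leb1]_y plateau eta (-1) 1 1 y.
have hI d x : high d x <= I by exact: high_profile_le.
have high0 d x : 0 <= high d x by exact: high_profile_ge0.
have I0 : 0 <= I by apply: le_trans (hI 1 0).
pose C := D * (I + 1).
have C0 : 0 < C by rewrite mulr_gt0// ltr_wpDl.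
exists C => // d nu d0 d1 nu0.
have shigh := @smooth_high_profile _ _ eta_kernel eta_ge0 d.
have high_supp := supported_high_profile eta_kernel eta_ge0 d0 d1.
have low0 := low_profile_ge0 eta_kernel eta_ge0 d.
have [iG EG] := Rintegral_affine d^-1 (- (C / (4 * nu))) (- (C * nu)) d0 (iQ d0 d1) (iw2 d0 d1).
have TT : 3 * T / 4 < T by have := T0; lra.
have pointwise z : K d z ->
    w z ^+ 2 * tensor chi2 (low d) z * d^-1 +
    w z ^+ 2 * - (C / (4 * nu)) + - (C * nu) <= F chi2 (high d) z.
  case: z => t x Ktx; have [t0 x0] := Ktriv Ktx.
  rewrite -addrA [leLHS]addrC /F /tensor/= lerD//.
    rewrite mulrN -opprD -[w (t, x) ^+ 2]mulr1.
    apply: young_flux => //; [exact: ltW|by rewrite ler01 lexx|].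
    rewrite mulr1 normrM ler_pM// ger0_norm//.
    by rewrite (le_trans (hI d x))// lerDl.
  rewrite derive1_high_profile// le_eqVlt; apply/orP; left; apply/eqP.
  by rewrite /low; ring.
have := @flux_le chi2 (high d) _ _ d _ schi2 shigh chi2_supp high_supp d0 d1 TT
  chi2_ge0 (high0 d) iG pointwise.
have init : 0 <= \int[leb1]_x (tensor chi2 (high d) (0, x) * ubar x).
  apply: Rintegral_ge0 => x _; rewrite /tensor /ubar indicE.
  by apply: mulr_ge0 => //; apply: mulr_ge0.
have X1 : \int[leb2]_(z in K d) (w z ^+ 2) <= \int[leb2]_(z in K 1) (w z ^+ 2).
  have i1 := iw2 ltr01 (lexx 1).
  rewrite /Rintegral fine_le//.
  - by apply: integrable_fin_num; [exact: mK|exact: iw2].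
  - by apply: integrable_fin_num; [exact: mK|exact: i1].
  - apply: ge0_subset_integral; [exact: mK|exact: mK|exact: (measurable_int _ i1)| |].
      by move=> z _; rewrite lee_fin sqr_ge0.
    move=> [t x] [tT /=]; rewrite !in_itv/= => /andP[x2 x0]; split=> //=.
    by rewrite in_itv/= x0 andbT (le_trans _ x2)// mulr1 ler_nMr.
rewrite EG => main.
have CX : C / (4 * nu) * \int[leb2]_(z in K d) (w z ^+ 2) <=
    C / (4 * nu) * \int[leb2]_(z in K 1) (w z ^+ 2).
  by apply: ler_wpM2l => //; apply: ltW; rewrite divr_gt0// mulr_gt0.
rewrite mulrC -ler_pdivrMr//; move: main CX init; rewrite -/(Q d).
set A := \int[leb1]_x _; set X := \int[leb2]_(z in K d) _; set Y := \int[leb2]_(z in K 1) _.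
rewrite mulrN [X * _]mulrC mulNr; move: (C / _ * X) (C / _ * Y) (C * nu * _) (Q d / d).
move=> *; lra.
Qed.

Lemma burgers_absurd : False.
Proof.
have [C C0 hC] := mass_le_flux; have [D D0 hD] := flux_small.
set X := \int[leb2]_(z in K 1) (w z ^+ 2) in hD.
have X0 : 0 <= X by apply: Rintegral_ge0 => z _; exact: sqr_ge0.
(* Order of choices: [mu] turns the error of [mass_le_flux] into [d / 4]; [nu] then makes the energy
   part of [flux_small] contribute at most [d / 4], whatever [d] is; finally [d] is small enough for
   the last part to contribute at most [d / 4]. The result [d <= 3 * d / 4] is absurd. *)
pose mu := (8 * C * T)^-1.
have mu0 : 0 < mu by rewrite invr_gt0 !mulr_gt0.
have [B B0 EB] : exists2 B : R, 0 < B & B = C / (4 * mu) * D.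
  by eexists; [|reflexivity]; rewrite mulr_gt0// divr_gt0// mulr_gt0.
have [nu nu0 Enu] : exists2 nu : R, 0 < nu & nu = B * X + 1.
  by eexists; [|reflexivity]; rewrite ltr_wpDl// mulr_ge0// ltW.
have BnT : 0 < B * nu * T by rewrite !mulr_gt0.
pose M := 8 * (B * nu * T) + 1.
have M1 : 1 <= M by rewrite lerDr; apply: ltW; rewrite mulr_gt0.
have M0 : 0 < M by exact: lt_le_trans M1.
pose d := M^-1.
have d0 : 0 < d by rewrite invr_gt0.
have d1 : d <= 1 by rewrite invf_le1.
have h1 := hC d mu d0 d1 mu0.
have h2 := hD d nu d0 d1 nu0.
have e1 : C * mu * (T * (2 * d)) = d / 4.
  by rewrite /mu; field; rewrite !gt_eqF.
have h3 : C / (4 * mu) * Q d <= d * (B * X / (4 * nu) + B * nu * T * 2 * d).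
  apply: (le_trans (ler_wpM2l _ h2)).
    by apply: ltW; rewrite divr_gt0// mulr_gt0.
  by rewrite le_eqVlt; apply/orP; left; apply/eqP; rewrite EB; field; rewrite !gt_eqF.
have h4 : B * X / (4 * nu) <= 1 / 4.
  rewrite ler_pdivrMr ?mulr_gt0// Enu.
  by have BX : 0 <= B * X; [rewrite mulr_ge0// ltW|lra].
have h5 : B * nu * T * 2 * d <= 1 / 4.
  rewrite /d ler_pdivrMr// /M.
  by lra.
have : d <= d * (1 / 4 + 1 / 4) + d / 4.
  rewrite (le_trans h1)// e1 lerD2r (le_trans h3)// ler_wpM2l ?lerD//.
  exact: ltW.
by have := d0; lra.
Qed.

End no_outflow.

(** * Weak limits *)

Section weak_limits.
Context {R : realType}.

Lemma Lfun_le1 d (X : measurableType d) (mu : {measure set X -> \bar R}) (A : set X)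
    (g : X -> R) (p : \bar R) : measurable A -> (mu A < +oo)%E -> measurable_fun setT g ->
  (forall x, `|g x| <= 1) -> (forall x, ~ A x -> g x = 0) -> (1 <= p)%E ->
  g \in Lfun mu p.
Proof.
move=> mA Aoo mg g1 gA p1; rewrite inE; apply/andP; split; rewrite inE//=.
rewrite /finite_norm unlock; case: p p1 => [r|_|//].
  rewrite lee_fin => r1; apply: poweR_lty; apply: le_lt_trans Aoo.
  have r0 : 0 < r by exact: lt_le_trans r1.
  rewrite -[leRHS]mul1e -integral_cst//.
  rewrite [leRHS]integral_mkcond; apply: ge0_le_integral => //.
  - by move=> x _; exact: poweR_ge0.
  - apply/measurable_EFinP; apply: (measurableT_comp (measurable_powR r)).
    exact: measurableT_comp.
  - by apply/(measurable_restrictT _ mA).1.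
  move=> x _; rewrite patchE; case: ifPn => [_|].
    have -> : cst 1%E x = (1 `^ r)%:E :> \bar R by rewrite powR1.
    by rewrite lee_fin ge0_ler_powR ?nnegrE// ltW.
  by rewrite notin_setE => /gA gx; rewrite /= gx normr0 powR0 ?gt_eqF.
case: ifPn => // _; apply: (@le_lt_trans _ _ 1%E); last exact: ltry.
by apply/ess_supP; apply: aeW => x /=; rewrite lee_fin.
Qed.

Lemma measurable_sgr (D : set R) : measurable D -> measurable_fun D (@Num.sg R).
Proof.
move=> mD; apply: nondecreasing_measurable => // x y xy.
have [x0|x0|x0] := ltgtP x 0.
- by rewrite (ltr0_sg x0); case: sgrP => _; rewrite ?lexx ?lerN10// (le_trans lerN10).
- by rewrite !gtr0_sg//; exact: lt_le_trans xy.
- by rewrite x0 sgr0 sgr_ge0 -x0.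
Qed.

Let box (T : R) : set (R * R) := `[0, T] `*` `]0, 4].

(** The test function is the sign of [w] on a box: bounded with support of finite measure, it
    belongs to L^p for every exponent, and pairing it with [w] gives the integral of [|w|]. *)
Lemma ae_eq0_weak (T : R) (w : R * R -> R) (p : \bar R) : 0 < T -> (1 <= p)%E ->
  measurable_fun (slab T%:E) w ->
  leb2.-integrable (`[0, T] `*` `[0, 4]) (fun z : R * R => (w z ^+ 2)%:E) ->
  (forall g, Lp_slab T%:E p g -> measurable_fun (slab T%:E) g ->
     (forall t x : R, x <= 0 -> g (t, x) = 0) ->
     \int[leb2]_(z in slab T%:E) (w z * g z) = 0) ->
  {ae leb2, forall z : R * R, 0 <= z.1 <= T -> 0 < z.2 <= 4 -> w z = 0}.
Proof.
move=> T0 p1 mw w2 wg.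
have mS : measurable (slab T%:E : set (R * R)) by apply: measurable_slab; rewrite lee_fin ltW.
have mB : measurable (box T) by apply: measurableX.
have BS : box T `<=` slab T%:E by rewrite slabE => z [? _]; split.
have mwB : measurable_fun (box T) w by exact: measurable_funS mw.
pose g := (fun z => Num.sg (w z)) \_ (box T).
have msg : measurable_fun (box T) (fun z => Num.sg (w z)).
  by apply: measurableT_comp mwB; exact: measurable_sgr.
have mg : measurable_fun setT g by exact: ((measurable_restrictT _ mB).1 msg).
have gS : g \_ (slab T%:E) = g.
  apply/funext => z; rewrite /g !patchE; case: ifPn => // zS; rewrite memNset// => /BS.
  by move: zS; rewrite notin_setE.
have Boo : (leb2 (box T) < +oo)%E.
  by rewrite product_measure1E//= !lebesgue_measure_itv/= !lte_fin T0 ltr0n -!EFinB -EFinM ltry.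
have gL : Lp_slab T%:E p g.
  rewrite /Lp_slab gS; apply: Lfun_le1; [exact: mB|exact: Boo|exact: mg| | |exact: p1].
    move=> z; rewrite /g patchE; case: ifPn => _; last by rewrite normr0.
    by rewrite normr_sg lern1; case: (_ == _).
  by move=> z zB; rewrite /g patchE memNset.
have g0 (t x : R) : x <= 0 -> g (t, x) = 0.
  move=> x0; rewrite /g patchE memNset// => -[_ /=].
  by rewrite in_itv/= ltNge x0.
have := wg g gL (measurable_funTS mg) g0.
have -> : \int[leb2]_(z in slab T%:E) (w z * g z) = \int[leb2]_(z in box T) `|w z|.
  rewrite Rintegral_mkcond [RHS]Rintegral_mkcond; apply: eq_Rintegral => z _.
  rewrite /g !patchE; have [zB|zB] := boolP (z \in box T).
    by rewrite mem_set; [rewrite mulrC -normrEsg|apply: BS; rewrite inE in zB].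
  by case: ifPn => //; rewrite mulr0.
(* [Rintegral] takes the value 0 on an infinite integral, so its vanishing is informative only once
   [|w|] is known to be integrable; [w ^+ 2 + 1] is a majorant. *)
have iB : leb2.-integrable (box T) (EFin \o (fun z => `|w z|)).
  have i1 : leb2.-integrable (box T) (EFin \o (fun z : R * R => w z ^+ 2 + 1)).
    apply: integrable_add_EFin; first exact: mB.
      apply: integrableS w2; [exact: measurableX|exact: mB|].
      by move=> [t x] [/= tT]; rewrite !in_itv/= => /andP[/ltW x0 x4]; split=> //=; rewrite x0.
    apply: measurable_bounded_integrable; [exact: mB|exact: Boo|exact: measurable_cst|].
    by exists 1; split; [exact: num_real|move=> y cy z _ /=; rewrite normr1 ltW].
  apply: integrable_dominated i1; [exact: mB|exact: measurableT_comp|].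
  move=> z _; rewrite normr_id.
  have := @normr_le_sqr _ (w z) 1 ltr01; rewrite mulr1 => /le_trans; apply.
  by rewrite lerD2r ler_pdivrMr// ler_peMr ?sqr_ge0// ler1n.
move=> int0.
have : (\int[leb2]_(z in box T) `|(w z)%:E| = 0)%E.
  rewrite -[LHS]fineK; first by congr EFin; exact: int0.
  by apply: integrable_fin_num; [exact: mB|exact: iB].
move/ae_eq_integral_abs => /(_ mB) ae0.
have mwE : measurable_fun (box T) (EFin \o w) by exact/measurable_EFinP.
have {}ae0 := ae0 mwE.
apply: filterS ae0 => -[t x] /= h tT x4.
by have [] : (w (t, x))%:E = 0%E by apply: h; split; rewrite /= in_itv.
Qed.

End weak_limits.

(** * Entropy solutions are weak solutions *)

Section entropy.
Context {R : realType}.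

Lemma ae2_imply (P Q : R * R -> Prop) : (forall z, P z -> Q z) ->
  {ae leb2, forall z : R * R, P z} -> {ae leb2, forall z : R * R, Q z}.
Proof.
by move=> PQ; apply: (@filterS _ _ (ae_filter_ringOfSetsType (lebesgue_measure \x lebesgue_measure)%E)).
Qed.

Lemma supported_itv_integral (f : R -> R) (a b : R) : supported a b f ->
  \int[leb1]_x f x = \int[leb1]_(x in `[a, b]) f x.
Proof.
move=> fs; rewrite [RHS]Rintegral_mkcond; apply: eq_Rintegral => x _; rewrite patchE.
case: ifPn => //; rewrite notin_setE/= in_itv/= => /negP; rewrite negb_and -!ltNge => xab.
by rewrite fs//; case/orP: xab => /ltW->; rewrite ?orbT.
Qed.

Lemma slab_tensor (f g : R -> R) (a b c d S : R) : continuous f -> continuous g ->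
  supported a b f -> supported c d g -> b <= S -> 0 <= S ->
  leb2.-integrable (slab +oo%E) (EFin \o tensor f g) /\
  \int[leb2]_(z in slab +oo%E) tensor f g z =
  (\int[leb1]_(t in `[0, S]) f t) * (\int[leb1]_x g x).
Proof.
move=> cf cg fs gs bS S0.
have [Cf Cf0 hf] := supported_bounded fs cf.
have gi := supported_integrable gs cg.
have mS : measurable (slab +oo%E : set (R * R)) by exact: measurable_slab.
pose G := tensor f g \_ (slab +oo%E).
have mG : measurable_fun setT G.
  by apply: ((measurable_restrictT _ mS).1 (measurable_funTS (measurable_tensor cf cg))).
have GE (t x : R) : G (t, x) = (f \_ `[0, S]) t * g x.
  rewrite /G !patchE; have [t0|t0] := leP 0 t.
    rewrite mem_set; last by split=> //; rewrite leey.
    have [tS|tS] := leP t S; first by rewrite mem_set//= in_itv/= t0.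
    rewrite memNset; last by rewrite /= in_itv/= => /andP[_]; rewrite leNgt tS.
    by rewrite mul0r /tensor/= fs ?mul0r// (le_trans bS (ltW tS)) orbT.
  rewrite memNset; last by case=> /=; rewrite leNgt t0.
  rewrite memNset ?mul0r//.
  by rewrite /= in_itv/= => /andP[]; rewrite leNgt t0.
have If (t : R) : \int[leb1]_x G (t, x) = (f \_ `[0, S]) t * \int[leb1]_x g x.
  by under eq_Rintegral do rewrite GE; rewrite RintegralZl.
have iGt (t : R) : leb1.-integrable setT (fun x => (G (t, x))%:E).
  rewrite (_ : (fun x => _) = (fun x => ((f \_ `[0, S]) t)%:E * (g x)%:E)%E).
    exact: integrableZl.
  by apply/funext => x; rewrite GE.
pose J := \int[leb1]_x `|g x|.
have J0 : 0 <= J by apply: Rintegral_ge0.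
have [iG _] : leb2.-integrable setT (EFin \o G) /\ `|\int[leb2]_z G z| <=
    \int[leb1]_(t in `[0, S]) (Cf * J).
  apply: tonelli_bound => //.
  - move=> t x tS; rewrite GE patchE memNset ?mul0r//=; exact/negP.
  - by apply: continuous_compact_integrable;
      [exact: segment_compact|apply: continuous_subspaceT => ?; exact: cvg_cst].
  - by move=> _; rewrite mulr_ge0// ltW.
  - apply: aeW => t _.
    have iJ : leb1.-integrable setT (EFin \o (fun x => `|g x|)) by exact: integrable_norm.
    have JE : J%:E = (\int[leb1]_x (`|g x|)%:E)%E.
      by rewrite /J /Rintegral fineK//; apply: integrable_fin_num => //; exact: iJ.
    have mJ : measurable_fun setT (fun x : R => (`|g x|)%:E) by exact: (measurable_int _ iJ).
    have -> : (Cf * J)%:E = (\int[leb1]_x (Cf%:E * (`|g x|)%:E))%E.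
      by rewrite EFinM JE ge0_integralZl// ?lee_fin// ltW.
    apply: ge0_le_integral => //.
    + apply: measurableT_comp => //; exact: (measurable_int _ (iGt t)).
    + apply/measurable_EFinP; apply: measurable_funM => //.
      exact/measurable_EFinP.
    move=> x _; rewrite GE abse_EFin -EFinM lee_fin normrM ler_wpM2r//.
    by rewrite patchE; case: ifPn => // _; rewrite normr0 ltW.
split.
  by apply/integrable_mkcond => //; rewrite restrict_EFin.
rewrite Rintegral_mkcond.
have -> : \int[leb2]_z G z = \int[leb1]_t (\int[leb1]_x G (t, x)).
  rewrite /Rintegral -(integral12_prod_meas1 iG); congr fine; apply: eq_integral => t _.
  by rewrite fineK//; exact: integrable_fin_num.
under eq_Rintegral do rewrite If.
have fi : leb1.-integrable `[0, S] (EFin \o f).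
  by apply: continuous_compact_integrable; [exact: segment_compact|exact: continuous_subspaceT].
have fi' : leb1.-integrable setT (EFin \o f \_ `[0, S]).
  by rewrite -restrict_EFin; move: fi; rewrite integrable_mkcond.
by rewrite RintegralZr// -Rintegral_mkcond.
Qed.

(** The norm of order [+oo] is the essential supremum only for a measure of positive total mass. *)
Lemma leb2_setT_gt0 : (0 < (@lebesgue_measure R \x @lebesgue_measure R) setT)%E.
Proof.
apply: (@lt_le_trans _ _ ((lebesgue_measure \x lebesgue_measure) (`[0%R, 1%R]%classic `*` `[0%R, 1%R]%classic : set (R * R)))%E).
  rewrite product_measure1E//= lebesgue_measure_itv/= lte_fin ltr01 oppr0 adde0.
  by rewrite mule1 lte01.
by apply: le_measure; rewrite ?inE//; exact: measurableX.
Qed.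

Lemma Lp_slab_bounded (T : \bar R) (u : R * R -> R) : (0 <= T)%E -> Lp_slab T +oo%E u ->
  measurable_fun (slab T) u /\ exists2 c : R, 1 <= c &
  {ae leb2, forall z : R * R, slab T z -> `|u z| <= c}.
Proof.
move=> T0; rewrite /Lp_slab inE => /andP[]; rewrite inE/= => mu.
rewrite inE/= /finite_norm unlock leb2_setT_gt0 => uoo.
split; first exact: ((measurable_restrictT _ (measurable_slab T0)).2 mu).
(* Raising the bound to at least 1 makes it dominate the datum [ubar] as well, which fixes the sign
   of [ubar x - m] later. *)
have [c c1 uc] : exists2 c : R, 1 <= c &
    (ess_sup (lebesgue_measure \x lebesgue_measure)%E (abse \o (EFin \o (u \_ (slab T)))) <= c%:E)%E.
  case: ess_sup uoo => [r|//|] _; last by exists 1; rewrite ?leNye.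
  by exists (Num.max r 1); rewrite ?lee_fin le_max lexx ?orbT.
exists c => //; move/ess_supP : uc; apply: ae2_imply => z /= + zT.
by rewrite patchE mem_set// lee_fin.
Qed.

Lemma ae_eq_slab (T : \bar R) (f g : R * R -> R) : (0 <= T)%E ->
  measurable_fun (slab T) f -> measurable_fun (slab T) g ->
  {ae leb2, forall z : R * R, slab T z -> f z = g z} ->
  \int[leb2]_(z in slab T) f z = \int[leb2]_(z in slab T) g z.
Proof.
move=> T0 mf mg fg; have mS := measurable_slab T0; rewrite /Rintegral; congr fine.
apply: ae_eq_integral; [exact: mS|exact/measurable_EFinP|exact/measurable_EFinP|].
by apply: ae2_imply fg => z fgz zT; congr EFin; exact: fgz.
Qed.

Lemma sgr_sqrB_le (x m : R) : x <= m -> Num.sg (x - m) * (x ^+ 2 - m ^+ 2) = m ^+ 2 - x ^+ 2.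
Proof.
rewrite le_eqVlt => /predU1P[->|xm]; first by rewrite !subrr mulr0.
by rewrite ltr0_sg ?subr_lt0// mulN1r opprB.
Qed.

Lemma sgr_sqrB_ge (x m : R) : m <= x -> Num.sg (x - m) * (x ^+ 2 - m ^+ 2) = x ^+ 2 - m ^+ 2.
Proof.
rewrite le_eqVlt => /predU1P[->|xm]; first by rewrite !subrr mulr0.
by rewrite gtr0_sg ?subr_gt0// mul1r.
Qed.

(* The entropy inequalities for the constants [m] and [-m], where m >= |u| a.e.,
   are the two halves of the weak formulation. *)
Lemma entropy_weak (u : R * R -> R) (chi psi : R -> R) (a b c d : R) :
  entropy_solution (@ubar R) u -> smooth chi -> smooth psi ->
  supported a b chi -> supported c d psi -> (forall t, 0 <= chi t) -> (forall x, 0 <= psi x) ->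
  \int[leb2]_(z in slab +oo%E) (u z * dt (tensor chi psi) z + u z ^+ 2 * dx (tensor chi psi) z)
    + \int[leb1]_x (tensor chi psi (0, x) * ubar x) = 0.
Proof.
move=> [uL uE] schi spsi chi_supp psi_supp chi0 psi0.
have {uE} uE e := uE e _ (test_function_tensor schi spsi chi_supp psi_supp (ltry b))
  (fun z => mulr_ge0 (chi0 z.1) (psi0 z.2)).
rewrite (dt_tensor psi schi) (dx_tensor chi spsi) in uE *.
have mS : measurable (slab +oo%E : set (R * R)) by exact: measurable_slab.
(* [b] may be negative; [S > 0] gives a nondegenerate interval [[0, S]] for the fundamental theorem
   of calculus. *)
pose S := Num.max b 1.
have bS : b <= S by rewrite le_max lexx.
have S0 : 0 < S by rewrite lt_max ltr01 orbT.
have cchi := smooth_continuous schi; have cpsi := smooth_continuous spsi.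
have cchi' := smooth_continuous (smooth_derive schi).
have cpsi' := smooth_continuous (smooth_derive spsi).
have chi'_supp := supported_derive chi_supp schi.
have psi'_supp := supported_derive psi_supp spsi.
have mt := measurable_tensor cchi' cpsi; have mx := measurable_tensor cchi cpsi'.
have [it Et] := slab_tensor cchi' cpsi chi'_supp psi_supp bS (ltW S0).
have [ix Ex] := slab_tensor cchi cpsi' chi_supp psi'_supp bS (ltW S0).
have chiS : chi S = 0 by apply: chi_supp; rewrite bS orbT.
rewrite (Rintegral_derive1 (fun x => @smooth_derivable _ chi x schi) cchi' S0) chiS sub0r in Et.
have psi'0 : \int[leb1]_x derive1 psi x = 0.
  have wide : supported (Num.min c d - 1) (d + 1) psi.
    move=> x xcd; apply: psi_supp; case/orP: xcd => xcd; apply/orP; [left|right].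
      by rewrite (le_trans xcd)// lerBlDr (le_trans (_ : _ <= c))// ?ge_min ?lexx// lerDl.
    by rewrite (le_trans _ xcd)// lerDl.
  have lt_cd : Num.min c d - 1 < d + 1.
    have : Num.min c d <= d by rewrite ge_min lexx orbT.
    by lra.
  rewrite (supported_itv_integral (supported_derive wide spsi)).
  rewrite (Rintegral_derive1 (fun x => @smooth_derivable _ psi x spsi) cpsi' lt_cd).
  by rewrite !wide ?lexx ?orbT// subrr.
rewrite psi'0 mulr0 in Ex.
have [mu [m m1 um]] := Lp_slab_bounded le0y uL.
have m0 : 0 <= m by exact: le_trans m1.
(* The truncation equals [u] almost everywhere on the slab but is bounded at every point, so
   integrability and the signs in the entropy integrands hold pointwise. *)
pose ub z := Num.max (- m) (Num.min (u z) m).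
have ubm z : - m <= ub z <= m.
  by rewrite /ub le_max lexx/= ge_max ge_min lexx orbT andbT (le_trans _ m0)// oppr_le0.
have ubn z : `|ub z| <= m by rewrite ler_norml.
have uub : {ae leb2, forall z : R * R, slab +oo%E z -> u z = ub z}.
  apply: ae2_imply um => z + zS => /(_ zS); rewrite ler_norml => /andP[mu' um'].
  by rewrite /ub min_l// max_r.
have mub : measurable_fun (slab +oo%E) ub.
  by apply: measurable_maxr => //; apply: measurable_minr.
have mt' := measurable_funTS (D := slab +oo%E) mt.
have mx' := measurable_funTS (D := slab +oo%E) mx.
set ft := tensor (derive1 chi) psi in uE it Et mt mt' *.
set fx := tensor chi (derive1 psi) in uE ix Ex mx mx' *.
have lin (e1 e2 : R) : leb2.-integrable (slab +oo%E) (EFin \o (fun z => ft z * e1 + fx z * e2)) /\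
    \int[leb2]_(z in slab +oo%E) (ft z * e1 + fx z * e2) = - chi 0 * (\int[leb1]_x psi x) * e1.
  have i1 : leb2.-integrable (slab +oo%E) (EFin \o (fun z => ft z * e1)).
    by apply: (@integrable_mul_bounded _ _ _ _ _ _ _ `|e1|); [exact: mS|exact: it| |].
  have i2 : leb2.-integrable (slab +oo%E) (EFin \o (fun z => fx z * e2)).
    by apply: (@integrable_mul_bounded _ _ _ _ _ _ _ `|e2|); [exact: mS|exact: ix| |].
  split; first by apply: integrable_add_EFin => //; exact: mS.
  rewrite RintegralD; [|exact: mS|exact: i1|exact: i2].
  rewrite RintegralZr; [|exact: mS|exact: it].
  rewrite RintegralZr; [|exact: mS|exact: ix].
  by rewrite Et Ex mul0r addr0.
have iub : leb2.-integrable (slab +oo%E) (EFin \o (fun z => ft z * ub z + fx z * ub z ^+ 2)).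
  apply: integrable_add_EFin; first exact: mS.
  - by apply: (@integrable_mul_bounded _ _ _ _ _ _ _ m); [exact: mS|exact: it|exact: mub|].
  - apply: (@integrable_mul_bounded _ _ _ _ _ _ _ (m ^+ 2));
      [exact: mS|exact: ix|exact: measurable_funX|].
    by move=> z _; rewrite normrX lerXn2r// nnegrE.
have mlin (e1 e2 : R) : measurable_fun (slab +oo%E) (fun z => ft z * e1 + fx z * e2).
  by apply: measurable_funD; apply: measurable_funM.
have mfub : measurable_fun (slab +oo%E) (fun z => ft z * ub z + fx z * ub z ^+ 2).
  by apply: measurable_funD; apply: measurable_funM => //; exact: measurable_funX.
have EA : \int[leb2]_(z in slab +oo%E) (u z * ft z + u z ^+ 2 * fx z) =
    \int[leb2]_(z in slab +oo%E) (ft z * ub z + fx z * ub z ^+ 2).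
  apply: ae_eq_slab => //.
  - apply: measurable_funD; apply: measurable_funM => //; exact: measurable_funX.
  - by apply: ae2_imply uub => z uz zS; rewrite uz// ![ub z * _]mulrC [ub z ^+ 2 * _]mulrC.
have mE e : measurable_fun (slab +oo%E)
    (fun z => `|u z - e| * ft z + Num.sg (u z - e) * (u z ^+ 2 - e ^+ 2) * fx z).
  have mue : measurable_fun (slab +oo%E) (fun z => u z - e) by exact: measurable_funB.
  apply: measurable_funD; apply: measurable_funM => //; first exact: measurableT_comp.
  apply: measurable_funM; first by apply: measurableT_comp => //; exact: measurable_sgr.
  by apply: measurable_funB => //; exact: measurable_funX.
set A := \int[leb2]_(z in slab +oo%E) (ft z * ub z + fx z * ub z ^+ 2) in EA *.
pose I := \int[leb1]_x psi x.
have Em : \int[leb2]_(z in slab +oo%E)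
    (`|u z - m| * ft z + Num.sg (u z - m) * (u z ^+ 2 - m ^+ 2) * fx z) = - chi 0 * I * m - A.
  have [il El] := lin m (m ^+ 2); rewrite -El -RintegralB; [|exact: mS|exact: il|exact: iub].
  apply: ae_eq_slab; [exact: le0y|exact: mE|exact: measurable_funB|].
  apply: ae2_imply uub => z uz zS; rewrite uz//; have /andP[l r] := ubm z.
  by rewrite sgr_sqrB_le// ler0_norm ?subr_le0//; ring.
have Ep : \int[leb2]_(z in slab +oo%E)
    (`|u z - - m| * ft z + Num.sg (u z - - m) * (u z ^+ 2 - (- m) ^+ 2) * fx z) =
    - chi 0 * I * m + A.
  have [il El] := lin m (- m ^+ 2); rewrite -El -RintegralD; [|exact: mS|exact: il|exact: iub].
  apply: ae_eq_slab; [exact: le0y|exact: mE|exact: measurable_funD|].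
  apply: ae2_imply uub => z uz zS; rewrite uz//; have /andP[l r] := ubm z.
  by rewrite sgr_sqrB_ge// ger0_norm ?subr_ge0// sqrrN; ring.
have ipsi := supported_integrable psi_supp cpsi.
have mubar : measurable_fun setT (@ubar R) by exact: measurable_indic.
have ubar01 x : 0 <= @ubar R x <= 1 by rewrite /ubar indicE; case: (_ \in _); rewrite ?lexx ler01.
have iB : leb1.-integrable setT (EFin \o (fun x => tensor chi psi (0, x) * ubar x)).
  rewrite (_ : (fun x => _) = (fun x => psi x * (chi 0 * ubar x))); last first.
    by apply/funext => x; rewrite /tensor/=; ring.
  apply: (@integrable_mul_bounded _ _ _ _ _ _ _ `|chi 0|) => //.
    exact: (measurable_funM (measurable_cst (chi 0)) mubar).
  move=> x _; have /andP[? ?] := ubar01 x.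
  by rewrite normrM ler_piMr// ger0_norm.
have iI e : leb1.-integrable setT (EFin \o (fun x => psi x * e)).
  by apply: (@integrable_mul_bounded _ _ _ _ _ _ _ `|e|).
set B := \int[leb1]_x (tensor chi psi (0, x) * ubar x).
have EBm : \int[leb1]_x (tensor chi psi (0, x) * `|ubar x - m|) = chi 0 * I * m - B.
  rewrite (_ : chi 0 * I * m = \int[leb1]_x (psi x * (chi 0 * m))).
    rewrite -RintegralB//; apply: eq_Rintegral => x _.
    have /andP[? ?] := ubar01 x.
    by rewrite ler0_norm ?subr_le0 ?(le_trans _ m1)// /tensor/=; ring.
  by rewrite RintegralZr// /I; ring.
have EBp : \int[leb1]_x (tensor chi psi (0, x) * `|ubar x - - m|) = chi 0 * I * m + B.
  rewrite (_ : chi 0 * I * m = \int[leb1]_x (psi x * (chi 0 * m))).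
    rewrite -RintegralD//; apply: eq_Rintegral => x _.
    have /andP[? ?] := ubar01 x.
    by rewrite ger0_norm ?opprK ?addr_ge0// /tensor/=; ring.
  by rewrite RintegralZr// /I; ring.
(* The constant [X] cancels between the slab and the initial integrals, leaving [A + B <= 0] from
   [m] and [0 <= A + B] from [- m]. *)
have := uE m; have := uE (- m); rewrite Em Ep EBm EBp EA !mulNr; move: (chi 0 * I * m) => X.
by clear; lra.
Qed.

End entropy.

(** * Passage to the limit and the two claims *)

Lemma weak_limit_right (R : realType) (eta : R -> R) (ueps : R -> R * R -> R) (T : R)
    (eps : nat -> R) (w : R * R -> R) :
  convolution_kernel eta -> (forall x : R, 0 <= x -> eta x = 0) ->
  (forall e : R, 0 < e <= 1 -> nonlocal_solution (rescale e eta) (@ubar R) (ueps e)) ->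
  0 < T -> vanishing eps -> some_weak_cvg T%:E (fun n => ueps (eps n)) w ->
  measurable_fun (slab T%:E) w ->
  leb2.-integrable (`[0, T] `*` `[0, 4]) (fun z : R * R => (w z ^+ 2)%:E) ->
  {ae leb2, forall z : R * R, 0 <= z.1 <= T -> 0 < z.2 <= 4 -> w z = 0}.
Proof.
move=> eta_kernel eta_ge0 sol T0 [eps01 _] wc mw w2.
(* Both modes of convergence are pairings against some L^q with [1 <= q], where [q] may be [+oo];
   the exponent matters no further. *)
have [p [q [q1 [_ _ cvg_wg]]]] : exists p q : \bar R, (1 <= q)%E /\
    pairing_cvg T%:E p q (fun n => ueps (eps n)) w.
  case: wc => [[p [p1 cvg_p]]|cvg_oo].
    by exists p%:E, (hoelder_conjugate p%:E); split=> //; exact: hoelder_conj_ge1.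
  by exists +oo%E, 1%E.
apply: (ae_eq0_weak T0 q1) => // g gL mg g0.
have E0 n : \int[leb2]_(z in slab T%:E) (ueps (eps n) z * g z) = 0.
  have [v_space v_sol] := sol _ (eps01 n).
  exact (integral_right_eq0 eta_kernel eta_ge0 (@smooth_rescale _ _ eta_kernel (eps n))
    (supported_rescale eta_kernel eta_ge0 (eps01 n)) v_space v_sol mg g0 (ltW T0)).
have /(cvg_lim (@Rhausdorff R)) <- := cvg_wg g gL.
by under eq_fun do rewrite E0; rewrite lim_cst//; exact: Rhausdorff.
Qed.

Theorem mainTheorem5 (R : realType) (eta : R -> R)
    (ueps : R -> R * R -> R) (u : R * R -> R)
    (eta_kernel : convolution_kernel eta)
    (eta_ge0 : forall x : R, 0 <= x -> eta x = 0)
    (ueps_sol : forall eps : R, 0 < eps <= 1 ->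
       nonlocal_solution (rescale eps eta) (@ubar R) (ueps eps))
    (u_sol : entropy_solution (@ubar R) u) :
  (forall T : R, 0 < T ->
     ~ exists eps : nat -> R,
         vanishing eps /\ some_weak_cvg T%:E (fun n => ueps (eps n)) u)
  /\
  (forall (T : R) (eps : nat -> R) (w : R * R -> R),
     0 < T -> vanishing eps ->
     some_weak_cvg T%:E (fun n => ueps (eps n)) w ->
     ~ L2loc_burgers_solution T%:E (@ubar R) w).
Proof.
have cbox (T a b : R) : compact (`[0, T] `*` `[a, b] : set (R * R)).
  by apply: compact_setX; exact: segment_compact.
have box_slab (T a b : R) : (`[0, T] `*` `[a, b] : set (R * R)) `<=` slab T%:E.
  by rewrite slabE => z [].
split=> [T T0 [eps [veps ucvg]]|T eps w T0 veps wcvg [[mw w2] wsol]].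
- have [mu [m m1 um]] := Lp_slab_bounded le0y u_sol.1.
  have slabT : slab T%:E `<=` (slab +oo%E : set (R * R)).
    by move=> z [z0 _]; split; rewrite ?leey.
  have muT : measurable_fun (slab T%:E) u.
    by apply: measurable_funS mu => //; exact: measurable_slab.
  have u2 (a b : R) : leb2.-integrable (`[0, T] `*` `[a, b]) (fun z : R * R => (u z ^+ 2)%:E).
    have mbox : measurable (`[0, T] `*` `[a, b] : set (R * R)) by exact: measurableX.
    have boxoo : (leb2 (`[0%R, T]%classic `*` `[a, b]%classic : set (R * R)) < +oo)%E.
      rewrite product_measure1E//= !lebesgue_measure_itv/=.
      by case: ifP => _; case: ifP => _; rewrite -?EFinB ?mule0 ?mul0e// -?EFinM ltry.
    have mub : measurable_fun (`[0, T] `*` `[a, b]) (fun z : R * R => u z ^+ 2).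
      apply: measurable_funX; apply: measurable_funS muT; last exact: box_slab.
      by apply: measurable_slab; rewrite lee_fin ltW.
    apply/integrableP; split; first exact/measurable_EFinP.
    apply: (@le_lt_trans _ _ (\int[leb2]_(z in `[0%R, T]%classic `*` `[a, b]%classic) (m ^+ 2)%:E)%E).
      apply: ae_ge0_le_integral => //.
      - by apply: measurableT_comp => //; exact/measurable_EFinP.
      - by move=> z _; rewrite lee_fin sqr_ge0.
      apply: ae2_imply um => z um zB; rewrite abse_EFin lee_fin normrX.
      have zS : slab +oo%E z by apply: slabT; exact: box_slab zB.
      by rewrite lerXn2r ?nnegrE ?um// (le_trans _ m1).
    rewrite integral_cst//; apply: lte_mul_pinfty; [by rewrite lee_fin sqr_ge0|by []|].
    exact: boxoo.
  have u_right := weak_limit_right eta_kernel eta_ge0 ueps_sol T0 veps ucvg muT (u2 _ _).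
  apply: (burgers_absurd eta_kernel eta_ge0 T0 muT (u2 _ _) u_right) => chi psi a b c d
    schi spsi chi_supp bT psi_supp chi0 psi0.
  (* The entropy solution is given for all times; a cutoff supported before [T] makes the integrals
     over the finite and the infinite slab agree. *)
  rewrite -[RHS](entropy_weak u_sol schi spsi chi_supp psi_supp chi0 psi0); congr (_ + _).
  rewrite (dt_tensor psi schi) (dx_tensor chi spsi) Rintegral_mkcond [RHS]Rintegral_mkcond.
  apply: eq_Rintegral => z _; rewrite !patchE.
  have [zT|zT] := boolP (z \in slab T%:E).
    by rewrite mem_set//; apply: slabT; rewrite inE in zT.
  case: ifPn => // zS; have Tz : T < z.1.
    rewrite ltNge; apply/negP => zT'; move: zT zS.
    by rewrite notin_setE inE => zT [z0 _]; apply: zT; split.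
  have bz : (z.1 <= a) || (b <= z.1) by rewrite (ltW (lt_trans bT Tz)) orbT.
  by rewrite /tensor (supported_derive chi_supp schi bz) (chi_supp _ bz) !mul0r !mulr0 addr0.
- have w_right := weak_limit_right eta_kernel eta_ge0 ueps_sol T0 veps wcvg mw
    (w2 _ (cbox _ _ _) (@box_slab _ _ _)).
  apply: (burgers_absurd eta_kernel eta_ge0 T0 mw (w2 _ (cbox _ _ _) (@box_slab _ _ _)) w_right)
    => chi psi a b c d schi spsi chi_supp bT psi_supp _ _.
  by apply: wsol; apply: (test_function_tensor schi spsi chi_supp psi_supp); rewrite lte_fin.
Qed.
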